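(* Let $\mathcal G$ be a finite connected planar graph (with a fixed planar embedding), $\beta>0$, and consider the Villain model on $\mathcal G$ with free boundary conditions at inverse temperature $\beta$ and the dual integer-restricted Gaussian field $n$ on $\mathcal G^*$ with Dirichlet boundary conditions at $\lambda=1/\beta$. Let $x\neq y$ be vertices of $\mathcal G$, $\gamma_{yx}$ an oriented simple path in $\mathcal G$ that begins at $y$ and ends at $x$, and $e=(x,x')$ an oriented edge such that $x'$ is not in $\gamma_{yx}$. Then for every $q\in\mathbb Z+\frac12$, $$\langle\sigma_x\cdot\sigma_y\rangle^{\mathrm{Vill},\mathcal G}_\beta\ \ge\ \mathbb P^{\mathcal G^*}_{1/\beta}\big[A^q_{\gamma_{yx},e}\big].$$ Furthermore, the inequality holds also with the fixed $q$ replaced by $\widetilde q(n)$, for any function $\widetilde q$ with values in $\mathbb Z+\frac12$ which is determined by the pair $\{n(x^+),n(x^-)\}$ of values of $n$ on the two faces sharing the edge $e$ ($x^+$ to the left of $e$, $x^-$ to its right); that is, with $A^q_{\gamma_{yx},e}$ replaced by the set of those $n$ for which the defining condition of $A^q_{\gamma_{yx},e}$ holds with $q=\widetilde q(n)$.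
   Context: Villain model on a finite graph $(V,E)$ with free boundary conditions: spins $\sigma_x=e^{i\theta_x}$, $\theta\in[-\pi,\pi)^V$, with probability density proportional to $\prod_{\{u,v\}\in E}\sum_{m\in\mathbb Z}\exp\big(-\frac\beta2(\theta_u-\theta_v+2\pi m)^2\big)$; $\langle\sigma_x\cdot\sigma_y\rangle$ is the expectation of $\cos(\theta_x-\theta_y)$. Dual height function: the vertices of $\mathcal G^*$ are the faces of $\mathcal G$ (including the outer face), and each edge of $\mathcal G$ gives a dual edge joining the two faces it borders. The integer-restricted Gaussian field at coupling $\lambda$ with Dirichlet boundary conditions is the probability measure $\mathbb P^{\mathcal G^*}_\lambda$ on functions $n$ from faces to $\mathbb Z$ vanishing on the outer face, with weights proportional to $\exp\big(-\frac\lambda2\sum(n_f-n_{f'})^2\big)$, the sum being over dual edges $\{f,f'\}$. Level lines: for $q\in\mathbb Z+\frac12$, an oriented edge of $\mathcal G$ is a $q$-edge if $n<q$ on the face to its right and $n>q$ on the face to its left. At each vertex the incoming and outgoing $q$-edges alternate in the cyclic order; each incoming $q$-edge is continued by the first outgoing $q$-edge met when rotating counterclockwise about the vertex starting from the incoming edge, i.e. starting on its right side (right-hand rule). This decomposes the $q$-edges into oriented non-crossing contours. A $q$-path is a segment of consecutive $q$-edges of such a contour. The event $A^q_{\gamma_{yx},e}$: there is a $q$-path $\kappa^q_{xy}$ which begins with the oriented edge $e$ and terminates at $y$, such that the concatenation $\gamma_{yx}\circ\kappa^q_{xy}$ is a simple loop of orientation $\mathrm{sgn}(q)$, where counterclockwise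 loops are positively oriented and clockwise loops negatively oriented. *)

(* Defs.v *)
From HB Require Import structures.
From mathcomp Require Import all_boot all_order all_algebra all_fingroup.
From mathcomp Require Import all_classical all_reals all_analysis.

Set Implicit Arguments.
Unset Strict Implicit.
Unset Printing Implicit Defensive.

Import Order.TTheory GRing.Theory Num.Theory.
Local Open Scope classical_set_scope.
Local Open Scope ring_scope.

(* A finite graph drawn on a closed oriented surface, given by its rotation
   system.  Every edge carries an arbitrary reference orientation, from [src]
   to [dst]; the oriented edge [(a, true)] follows it and [(a, false)] reverses
   it.  [rotation d] is the next oriented edge after [d], counterclockwise,
   among those leaving the same vertex.  Parallel edges and loops are allowed. *)
Record ribbonGraph := RibbonGraph {
  vertex : finType;
  edge : finType;
  src : edge -> vertex;
  dst : edge -> vertex;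
  rotation : {perm edge * bool};
  rotation_orbit : forall d d' : edge * bool,
    (d' \in porbit rotation d) =
    ((if d'.2 then src d'.1 else dst d'.1) == (if d.2 then src d.1 else dst d.1))
}.

Section Ribbon.
Variable G : ribbonGraph.

Definition dart : finType := (edge G * bool)%type.

Definition origin (d : dart) : vertex G := if d.2 then src d.1 else dst d.1.
Definition rev (d : dart) : dart := (d.1, ~~ d.2).
Definition target (d : dart) : vertex G := origin (rev d).

Lemma rev_involutive : involutive rev.
Proof. by case=> a b; rewrite /rev /= negbK. Qed.

(* Arriving at [target d], turn clockwise from the edge just traversed, so that
   the face on the left of [d] stays on the left.  Faces are the orbits of this
   permutation. *)
Definition face_perm : {perm dart} :=
  (perm (inv_inj rev_involutive) * (@rotation G)^-1)%g.

Lemma face_permE (d : dart) : face_perm d = ((@rotation G)^-1)%g (rev d).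
Proof. by rewrite permM permE. Qed.

Definition face : finType := {f : {set dart} | f \in porbits face_perm}.

Lemma porbit_face (d : dart) : porbit face_perm d \in porbits face_perm.
Proof. by apply: imset_f. Qed.

Definition left_face (d : dart) : face := Sub (porbit face_perm d) (porbit_face d).
Definition right_face (d : dart) : face := left_face (rev d).

Definition adjacent (u v : vertex G) : bool :=
  [exists d : dart, (origin d == u) && (target d == v)].

End Ribbon.

(* A connected plane graph up to homeomorphism of the plane: a connected
   rotation system of genus 0 together with the choice of the unbounded face.
   The one-vertex graph without edges, whose only face is not an orbit of
   oriented edges, is not represented. *)
Record planeGraph := PlaneGraph {
  ribbon :> ribbonGraph;
  plane_connected : forall u v : vertex ribbon, connect (@adjacent ribbon) u v;
  plane_euler : (#|vertex ribbon| + #|face ribbon| = #|edge ribbon| + 2)%N;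
  outer : face ribbon
}.

Section Walks.
Variable G : ribbonGraph.

Fixpoint is_walk (u v : vertex G) (s : seq (dart G)) : bool :=
  if s is d :: s' then (origin d == u) && is_walk (target d) v s' else u == v.

(* the vertices visited by a walk starting at [u] *)
Definition visits (u : vertex G) (s : seq (dart G)) : seq (vertex G) :=
  u :: [seq target d | d <- s].

Definition simple_path (u v : vertex G) (s : seq (dart G)) : bool :=
  is_walk u v s && uniq (visits u s).

(* The last clause excludes the traversal of one edge back and forth. *)
Definition simple_loop (s : seq (dart G)) : bool :=
  [&& s != [::], path.cycle (fun d d' : dart G => target d == origin d') s,
      uniq [seq origin d | d <- s] & uniq [seq d.1 | d <- s]].

End Walks.

Section Orientation.
Variable G : planeGraph.

Definition dual_adjacent_off (l : seq (dart G)) (f f' : face G) : bool :=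
  [exists d : dart G, [&& d \notin l, rev d \notin l,
                          left_face d == f & right_face d == f']].

(* [f] is separated from infinity by [l] *)
Definition encloses (l : seq (dart G)) (f : face G) : bool :=
  ~~ connect (dual_adjacent_off l) f (outer G).

(* A simple loop runs counterclockwise when its interior is on its left. *)
Definition counterclockwise (l : seq (dart G)) : bool :=
  all (fun d => encloses l (left_face d)) l.
Definition clockwise (l : seq (dart G)) : bool :=
  all (fun d => encloses l (right_face d)) l.

(* Used for [q] half-integer, hence nonzero. *)
Definition has_orientation_sgn (q : rat) (l : seq (dart G)) : bool :=
  if 0 < q then counterclockwise l else clockwise l.

End Orientation.

Section LevelLines.
Variable G : planeGraph.

Definition height : choiceType := {ffun face G -> int}.

Definition half_integer (q : rat) : Prop := exists k : int, q = k%:~R + 2^-1.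

Definition q_edge (n : height) (q : rat) (d : dart G) : bool :=
  (n (right_face d))%:~R < q < (n (left_face d))%:~R.

(* [rev d] is the incoming edge [d] seen from its endpoint: the contour goes on
   with the first outgoing [q]-edge met counterclockwise after it. *)
Definition continued_by (n : height) (q : rat) (d d' : dart G) : Prop :=
  exists k : nat,
    [/\ d' = iter k.+1 (@rotation G) (rev d), q_edge n q d' &
        forall j : nat, (j < k)%N -> ~~ q_edge n q (iter j.+1 (@rotation G) (rev d))].

Fixpoint contour_from (n : height) (q : rat) (d : dart G) (s : seq (dart G)) :
    Prop :=
  if s is d' :: s' then continued_by n q d d' /\ contour_from n q d' s'
  else True.

(* the sequence [d :: s] is a [q]-path *)
Definition q_path (n : height) (q : rat) (d : dart G) (s : seq (dart G)) :
    Prop :=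
  q_edge n q d /\ contour_from n q d s.

(* the condition defining A^q_{gamma, e}, for gamma ending at [origin e] *)
Definition A_event (y : vertex G) (gamma : seq (dart G)) (e : dart G)
    (q : rat) (n : height) : Prop :=
  exists s : seq (dart G),
    [/\ q_path n q e s, target (last e s) = y,
        simple_loop (gamma ++ e :: s) &
        has_orientation_sgn q (gamma ++ e :: s)].

End LevelLines.

Section IntegerRestrictedGaussian.
Variables (R : realType) (G : planeGraph).

Definition dirichlet (n : height G) : Prop := n (outer G) = 0.

(* every edge of G is one dual edge *)
Definition ivgff_weight (lambda : R) (n : height G) : R :=
  expR (- (lambda / 2) *
    \sum_(a : edge G)
      ((n (@left_face G (a, true)) - n (@right_face G (a, true)))%:~R) ^+ 2).

Definition ivgff_mass (lambda : R) (A : set (height G)) : R :=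
  fine (\esum_(n in [set n | dirichlet n /\ A n]) (ivgff_weight lambda n)%:E).

Definition ivgff_prob (lambda : R) (A : set (height G)) : R :=
  ivgff_mass lambda A / ivgff_mass lambda setT.

End IntegerRestrictedGaussian.

Section Villain.
Variables (R : realType) (G : ribbonGraph).

Definition villain_edge (beta : R) (t : R) : R :=
  fine (\esum_(m in [set: int])
    (expR (- (beta / 2) * (t + 2 * pi * m%:~R) ^+ 2))%:E).

Definition villain_weight (beta : R) (theta : vertex G -> R) : R :=
  \prod_(a : edge G) villain_edge beta (theta (src a) - theta (dst a)).

(* Iterated Lebesgue integral of [F] over [-pi, pi) in the coordinates listed
   in [s], the other ones being those of [theta]. *)
Fixpoint angle_integral_over (s : seq (vertex G)) (F : (vertex G -> R) -> R)
    (theta : vertex G -> R) : R :=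
  if s is v :: s' then
    \int[lebesgue_measure]_(t in `[- pi, pi[)
      angle_integral_over s' F (fun u => if u == v then t else theta u)
  else F theta.

(* the integral over [-pi, pi)^V *)
Definition angle_integral (F : (vertex G -> R) -> R) : R :=
  angle_integral_over (enum (vertex G)) F (fun=> 0).

Definition villain_mean (beta : R) (F : (vertex G -> R) -> R) : R :=
  angle_integral (fun theta => F theta * villain_weight beta theta) /
  angle_integral (villain_weight beta).

Definition villain_corr (beta : R) (x y : vertex G) : R :=
  villain_mean beta (fun theta => cos (theta x - theta y)).

End Villain.

(* Main.v *)
(** Fourier expansion (Poisson summation) of each edge weight turns the spin
    correlation into a ratio of Gaussian sums over integer currents with
    prescribed divergence.  On a plane graph divergence-free currents are
    gradients of heights, so the correlation equals the ratio of
    [\sum_n w(dn - gamma)] and [\sum_n w(dn)] over Dirichlet heights [n].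

    It remains to bound the part of the second sum carried by the event by the
    first sum.  Decompose the event according to the contour [kappa] and the
    heights on the faces that the right-hand rule inspects while following it;
    this data is decided by those heights alone.  The simple loop
    [gamma ++ kappa] is the gradient of a height [h], and the substitution
    [n -> n + h] removes [gamma] at the price of lowering by one all the pinned
    heights above [q]; the orientation [sgn q] of the loop is what makes this
    compatible with the Dirichlet condition.  The edges of [kappa] only
    contribute a common factor, since both their sides are pinned.  Lowering the
    heights above [q] increases the pinned Gaussian partition function, by the
    Ahlswede-Daykin four functions theorem and the reflection symmetry. *)

Require Import Defs.
From HB Require Import structures.
From mathcomp Require Import all_boot all_order all_algebra all_fingroup.
From mathcomp Require Import all_classical all_reals all_analysis.
From mathcomp Require Import ring lra zify.

Set Implicit Arguments.
Unset Strict Implicit.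
Unset Printing Implicit Defensive.

Import Order.TTheory GRing.Theory Num.Theory.
Import numFieldNormedType.Exports.
Local Open Scope classical_set_scope.
Local Open Scope ring_scope.

(** The right-hand rule makes the pinned data match the loop potential: a sweep starts on the right
    of the contour, below [q], and stays below [q] until it meets a [q]-edge, without crossing the
    loop. Hence on every inspected face [h] is a constant plus the indicator of [n > q], and
    subtracting [h] from the pinned values is, up to a global shift, the lowering by one. Heights on
    the other faces are summed over, so nothing about them has to match. Planarity enters through
    Euler's formula, which makes divergence-free currents exact; the two values of [h] along the
    loop then play the role of the two sides in the Jordan curve theorem. On the spin side only
    ratios matter: the constant of the Poisson formula stays unevaluated, since it occurs to the
    same power in both integrals. Sums and integrals are interchanged by uniform approximation with
    finite trigonometric polynomials over symmetric boxes, dominated by Gaussian weights. *)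

Local Notation rev := Defs.rev.

(** * Flows and heights on a plane graph *)

Section DualFlows.
Variable G : ribbonGraph.

Definition coboundary (T : zmodType) (h : face G -> T) (d : dart G) : T :=
  h (left_face d) - h (right_face d).

Lemma revK (d : dart G) : rev (rev d) = d.
Proof. exact: rev_involutive. Qed.

Lemma coboundary_rev (T : zmodType) (h : face G -> T) d :
  coboundary h (rev d) = - coboundary h d.
Proof. by rewrite /coboundary /right_face revK opprB. Qed.

Lemma rotation_origin (d : dart G) : origin (@rotation G d) = origin d.
Proof.
by have := mem_porbit (@rotation G) 1 d; rewrite expg1 rotation_orbit => /eqP.
Qed.

(** The angular sector between [d] and the next dart counterclockwise lies in a single face:
    [face_perm] maps [rev (rotation d)] to [d]. *)
Lemma right_face_rotation (d : dart G) :
  right_face (@rotation G d) = left_face d.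
Proof.
apply: val_inj; rewrite /right_face /left_face /=.
apply/eqP; rewrite eq_porbit_mem.
have {2}-> : d = face_perm G (rev (@rotation G d)).
  by rewrite face_permE revK permK.
by rewrite porbit_sym; have := mem_porbit (face_perm G) 1 (rev (@rotation G d)); rewrite expg1.
Qed.

Lemma face_rep (f : face G) : exists d, f = left_face d.
Proof.
case: f => F PF; have /imsetP[d _ Fd] := PF.
by exists d; apply: val_inj.
Qed.

Definition divergence (T : zmodType) (j : edge G -> T) (v : vertex G) : T :=
  \sum_(a | src a == v) j a - \sum_(a | dst a == v) j a.

Lemma sum_dart (T : nmodType) (P : pred (dart G)) (F : dart G -> T) :
  \sum_(d | P d) F d = \sum_(a | P (a, true)) F (a, true)
                     + \sum_(a | P (a, false)) F (a, false).
Proof.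
rewrite big_mkcond /= (eq_bigr (fun p => if P (p.1, p.2) then F (p.1, p.2) else 0)).
  rewrite -(pair_bigA _ (fun a b => if P (a, b) then F (a, b) else 0)) /=.
  under eq_bigr do rewrite big_bool /=.
  by rewrite big_split /= -!big_mkcond.
by case.
Qed.

Lemma divergence_dart (T : zmodType) (c : dart G -> T) v :
  (forall d, c (rev d) = - c d) ->
  divergence (fun a => c (a, true)) v = \sum_(d | origin d == v) c d.
Proof.
move=> crev; rewrite sum_dart /divergence -sumrN; congr (_ + _).
by apply: eq_bigr => a _; rewrite -crev.
Qed.

(** Turning around [v], the right face of each dart is the left face of the preceding one, so the
    sum telescopes cyclically. *)
Lemma divergence_coboundary (T : zmodType) (h : face G -> T) v :
  divergence (fun a => coboundary h (a, true)) v = 0.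
Proof.
rewrite (divergence_dart _ (coboundary_rev h)) sumrB.
rewrite [X in _ - X](reindex_inj (@perm_inj _ (@rotation G))) /=.
rewrite [X in _ - X](eq_bigl (fun d => origin d == v)) => [|d]; last first.
  by rewrite rotation_origin.
by under [X in _ - X]eq_bigr do rewrite right_face_rotation; rewrite subrr.
Qed.

Hypothesis connected : forall u v : vertex G, connect (@Defs.adjacent G) u v.

Lemma vertex_const (T : Type) (u : vertex G -> T) :
  (forall a, u (src a) = u (dst a)) -> forall v w, u v = u w.
Proof.
move=> usd v w; have /connectP[p] := connected v w.
elim: p v => [|v' p IH] v /= => [_ -> //|/andP[/existsP[d /andP[/eqP <- /eqP Ed]] pp] Ew].
rewrite -(IH _ pp Ew) -Ed; case: (d) => a [] /=; rewrite /target /origin /=.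
  exact: usd.
exact/esym/usd.
Qed.

(** Connectivity of the dual graph, deduced from that of [G]: the faces around one vertex are linked
    by rotation, those around neighbouring vertices by a common edge, and every face has a dart. *)
Lemma face_const (T : Type) (h : face G -> T) :
  (forall d, h (left_face d) = h (right_face d)) -> forall f f', h f = h f'.
Proof.
move=> hlr.
have hrot k d : h (left_face (iter k (@rotation G) d)) = h (left_face d).
  by elim: k => //= k IH; rewrite hlr right_face_rotation.
have horig d d' : origin d = origin d' -> h (left_face d) = h (left_face d').
  move=> Eo; have : d' \in porbit (@rotation G) d.
    by rewrite rotation_orbit; apply/eqP.
  by move=> /porbitP[i ->]; rewrite permX hrot.
move=> f f'; have [d ->] := face_rep f; have [d' ->] := face_rep f'.
have /connectP[p] := connected (origin d) (origin d').
elim: p d => [|v p IH] d /= => [_ Ed|/andP[/existsP[b /andP[/eqP Eb /eqP Ev]] pp] Ew].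
  exact/horig.
rewrite (horig d b) // hlr -[RHS](IH (rev b)) //; first by rewrite -/(target b) Ev.
by rewrite -/(target b) Ev.
Qed.

End DualFlows.

Section Potential.
Variable G : planeGraph.
Let F := #|face G|. Let E := #|edge G|. Let V := #|vertex G|.

(** The kernel lies on the line of constant vectors, hence has dimension at most one. *)
Lemma rank_ge_of_const_kernel (m n : nat) (M : 'M[rat]_(m, n)) :
  (forall h : 'rV_m, h *m M = 0 -> forall i j, h 0 i = h 0 j) ->
  (m.-1 <= \rank M)%N.
Proof.
move=> Mconst.
have : (kermx M <= (const_mx 1 : 'rV[rat]_m))%MS.
  apply/row_subP => i; have rM : row i (kermx M) *m M = 0.
    by rewrite -row_mul mulmx_ker row0.
  have [j0|mE] := pickP (@predT 'I_m); last by have := mE i.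
  move=> _; rewrite (_ : row i _ = (row i (kermx M)) 0 j0 *: const_mx 1) ?scalemx_sub //.
  by apply/rowP => j; rewrite [RHS]mxE [X in _ * X]mxE mulr1; apply: Mconst.
move=> /mxrankS; rewrite mxrank_ker => /leq_trans/(_ (rank_leq_row _)).
by move: (\rank M) => r; lia.
Qed.

Let D : 'M[rat]_(F, E) := \matrix_(f, a)
  ((left_face (enum_val a, true) == enum_val f)%:R
   - (right_face (enum_val a, true) == enum_val f)%:R).

Let B : 'M[rat]_(E, V) := \matrix_(a, v)
  ((src (enum_val a) == enum_val v)%:R - (dst (enum_val a) == enum_val v)%:R).

Lemma sum_delta (T : finType) (h : T -> rat) (t : T) :
  \sum_(i < #|T|) h (enum_val i) * (t == enum_val i)%:R = h t.
Proof.
rewrite -(big_enum_val (fun s => h s * (t == s)%:R)) /=.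
rewrite (bigD1 t) //= eqxx mulr1 big1 ?addr0 // => s /negPf nst.
by rewrite eq_sym nst mulr0.
Qed.

Let mulD (h : face G -> rat) a :
  ((\row_f h (enum_val f)) *m D) 0 a = coboundary h (enum_val a, true).
Proof.
rewrite mxE; under eq_bigr do rewrite !mxE mulrBr.
by rewrite sumrB !sum_delta.
Qed.

Let mulBT (u : vertex G -> rat) a :
  ((\row_v u (enum_val v)) *m B^T) 0 a = u (src (enum_val a)) - u (dst (enum_val a)).
Proof.
rewrite mxE; under eq_bigr do rewrite !mxE mulrBr.
by rewrite sumrB !sum_delta.
Qed.

Let mulB (j : edge G -> rat) v :
  ((\row_a j (enum_val a)) *m B) 0 v = divergence j (enum_val v).
Proof.
rewrite mxE; under eq_bigr do rewrite !mxE mulrBr.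
rewrite sumrB /divergence; congr (_ - _).
  rewrite -(big_enum_val (fun a => j a * (src a == enum_val v)%:R)) /= [RHS]big_mkcond.
  by apply: eq_bigr => a _; case: ifP; rewrite ?mulr1 ?mulr0.
rewrite -(big_enum_val (fun a => j a * (dst a == enum_val v)%:R)) /= [RHS]big_mkcond.
by apply: eq_bigr => a _; case: ifP; rewrite ?mulr1 ?mulr0.
Qed.

Let row_fun (T : finType) (h : 'rV[rat]_#|T|) :
  h = \row_i (fun t => h 0 (enum_rank t)) (enum_val i).
Proof. by apply/rowP => i; rewrite mxE enum_valK. Qed.

(* Rank count: the gradient has rank at least F - 1 and the divergence at least
   V - 1, and by Euler's formula these add up to the number of edges. *)
Lemma divergence_free_coboundary (j : edge G -> int) :
  (forall v, divergence j v = 0) ->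
  exists h : face G -> int,
    h (outer G) = 0 /\ forall a, j a = coboundary h (a, true).
Proof.
move=> j0.
have rkD : (F.-1 <= \rank D)%N.
  apply: rank_ge_of_const_kernel => h hD i i'.
  rewrite -(enum_valK i) -(enum_valK i').
  apply: (face_const (@plane_connected G) (h := fun t => h 0 (enum_rank t))) => d.
  have cob0 a : coboundary (fun t => h 0 (enum_rank t)) (a, true) = 0.
    by rewrite -[a](enum_rankK a) -mulD -row_fun hD mxE.
  apply/eqP; rewrite -subr_eq0; apply/eqP.
  rewrite -[LHS]/(coboundary (fun t => h 0 (enum_rank t)) d).
  by case: d => a [] //; rewrite -[(a, false)]/(rev (a, true)) coboundary_rev cob0 oppr0.
have rkB : (V.-1 <= \rank B)%N.
  rewrite -mxrank_tr; apply: rank_ge_of_const_kernel => u uB i i'.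
  rewrite -(enum_valK i) -(enum_valK i').
  apply: (vertex_const (@plane_connected G) (u := fun t => u 0 (enum_rank t))) => a.
  apply/eqP; rewrite -subr_eq0 -[a](enum_rankK a).
  by rewrite -(mulBT (fun t => u 0 (enum_rank t))) -row_fun uB mxE.
have DB : D *m B = 0.
  apply/row_matrixP => i; rewrite row_mul row0.
  apply/rowP => v; rewrite [RHS]mxE.
  have -> : row i D = \row_a (fun a => coboundary
      (fun f => (f == enum_val i)%:R : rat) (a, true)) (enum_val a).
    by apply/rowP => a; rewrite !mxE.
  rewrite (mulB (fun a => coboundary (fun f => (f == enum_val i)%:R : rat) (a, true))).
  exact: divergence_coboundary.
have Dker : (D <= kermx B)%MS by apply/sub_kermxP.
have kerD : (kermx B <= D)%MS.
  rewrite -(mxrank_leqif_sup Dker).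
  rewrite eqn_leq mxrankS //= mxrank_ker.
  apply: leq_trans rkD; rewrite leq_subLR.
  have := @plane_euler G; rewrite -/F -/E -/V => VFE.
  have : (0 < F)%N by apply/card_gt0P; exists (outer G).
  by move: rkB; lia.
have : (\row_a (fun a => (j a)%:~R : rat) (enum_val a) <= D)%MS.
  apply: submx_trans kerD; apply/sub_kermxP/rowP => v; rewrite (mulB (fun a => (j a)%:~R)) mxE /divergence.
  by rewrite -!rmorph_sum /= -rmorphB /= -/(divergence j _) j0.
move=> /submxP[h hD].
pose H f := h 0 (enum_rank f).
have jH a : (j a)%:~R = coboundary H (a, true).
  by rewrite -{2}[a](enum_rankK a) -mulD -row_fun -hD mxE enum_rankK.
have Hint d : coboundary H d \is a Num.int.
  case: d => a []; first by rewrite -jH intr_int.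
  by rewrite -[(a, false)]/(rev (a, true)) coboundary_rev -jH rpredN intr_int.
(* Linear algebra gives a rational potential only. Its increments are integers, so once it vanishes
   at the outer face integrality spreads from face to face. *)
pose H0 f := H f - H (outer G).
have H0int f : H0 f \is a Num.int.
  have -> : (H0 f \is a Num.int) = (H0 (outer G) \is a Num.int).
    apply: (face_const (@plane_connected G) (h := fun f => H0 f \is a Num.int)) => d.
    have -> : H0 (left_face d) = coboundary H d + H0 (right_face d).
      by rewrite /H0 /coboundary addrA subrK.
    by rewrite rpredDl.
  by rewrite /H0 subrr rpred0.
exists (fun f => Num.floor (H0 f)); split.
  by rewrite /H0 subrr floor0.
move=> a; apply: (@intr_inj rat); rewrite jH /coboundary.
by rewrite rmorphB /= !floorK // /H0 opprB addrA subrK.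
Qed.

End Potential.

Lemma uniq_map_inj (T1 T2 : eqType) (g : T1 -> T2) (s : seq T1) :
  uniq (map g s) -> {in s &, injective g}.
Proof.
elim: s => //= t s IH /andP[gts /IH gs] u v; rewrite !inE.
case/predU1P => [->|us]; case/predU1P => [->|vs] // E; last exact: gs.
  by move: gts; rewrite E map_f.
by move: gts; rewrite -E map_f.
Qed.

(** * The potential of a simple loop and its two values along the loop *)

Section Loops.
Variable G : ribbonGraph.

Definition flow (l : seq (dart G)) (d : dart G) : int :=
  (count_mem d l)%:Z - (count_mem (rev d) l)%:Z.

Lemma flow_rev l d : flow l (rev d) = - flow l d.
Proof. by rewrite /flow revK opprB. Qed.

Lemma flow_cat l l' d : flow (l ++ l') d = flow l d + flow l' d.
Proof. by rewrite /flow !count_cat !PoszD; ring. Qed.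

Lemma divergence_flow l v : divergence (fun a => flow l (a, true)) v =
  (count (fun d => origin d == v) l)%:Z - (count (fun d => target d == v) l)%:Z.
Proof.
rewrite (divergence_dart _ (flow_rev l)) sumrB; congr (_ - _).
  elim: l => [|d l IH] /=; first by rewrite big1.
  under eq_bigr do rewrite PoszD; rewrite big_split /= {}IH PoszD; congr (_ + _).
  rewrite big_mkcond (bigD1 d) //= eqxx big1 ?addr0; first by case: ifP.
  by move=> d' nd; rewrite [d == d']eq_sym (negPf nd) if_same.
elim: l => [|d l IH] /=; first by rewrite big1.
under eq_bigr do rewrite PoszD; rewrite big_split /= {}IH PoszD; congr (_ + _).
rewrite big_mkcond (bigD1 (rev d)) //= revK eqxx big1 ?addr0; first by case: ifP.
move=> d' nd; rewrite (_ : (d == rev d') = false) ?if_same //.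
by apply: contra_neqF nd => /eqP ->; rewrite revK.
Qed.

Lemma divergence_walk u w l v : is_walk u w l ->
  divergence (fun a => flow l (a, true)) v = (u == v)%:Z - (w == v)%:Z.
Proof.
rewrite divergence_flow; elim: l u => [|d l IH] u /=; first by move=> /eqP ->; rewrite !subrr.
move=> /andP[/eqP <- /IH]; rewrite !PoszD => E.
by rewrite opprD addrACA E; ring.
Qed.

Lemma walk_of_path (d : dart G) p :
  path (fun d d' : dart G => target d == origin d') d p ->
  is_walk (origin d) (target (last d p)) (d :: p).
Proof.
elim: p d => [|d' p IH] d /=; first by rewrite !eqxx.
by move=> /andP[/eqP Ed /IH /=]; rewrite !eqxx Ed eqxx.
Qed.

Variable l : seq (dart G).
Hypothesis loop : simple_loop l.

Let l0 : l != [::]. Proof. by case/and4P: loop. Qed.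
Let cyc : path.cycle (fun d d' : dart G => target d == origin d') l.
Proof. by case/and4P: loop. Qed.
Let uniq_origin : uniq [seq origin d | d <- l]. Proof. by case/and4P: loop. Qed.
Let uniq_edge : uniq [seq d.1 | d <- l]. Proof. by case/and4P: loop. Qed.

Lemma loop_uniq : uniq l. Proof. exact: map_uniq uniq_edge. Qed.

Lemma origin_inj : {in l &, injective (@origin G)}.
Proof. by move=> d d' dl dl'; apply: (uniq_map_inj uniq_origin). Qed.

Lemma loop_rev d : d \in l -> rev d \notin l.
Proof.
move=> dl; apply/negP => rl.
have /(_ erefl) := uniq_map_inj uniq_edge dl rl.
by case: d {dl rl} => a []; rewrite /rev.
Qed.

Lemma flow_loop d : d \in l -> flow l d = 1.
Proof.
move=> dl; rewrite /flow (count_uniq_mem _ loop_uniq) dl.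
by rewrite (count_memPn (loop_rev dl)).
Qed.

Lemma flow_off d : d \notin l -> rev d \notin l -> flow l d = 0.
Proof. by move=> dl rl; rewrite /flow !(count_memPn _). Qed.

Lemma divergence_loop v : divergence (fun a => flow l (a, true)) v = 0.
Proof.
move: l0 cyc; case: (l) => // d p _; rewrite /= rcons_path => /andP[/walk_of_path wp /eqP E].
by rewrite (divergence_walk _ wp) E subrr.
Qed.

Lemma next_origin d : d \in l -> origin (next l d) = target d.
Proof. by move=> dl; have /eqP <- := next_cycle cyc dl. Qed.

Lemma iter_period (T : Type) (g : T -> T) t m i :
  iter m g t = t -> iter i g t = iter (i %% m) g t.
Proof.
move=> gm; rewrite {1}(divn_eq i m) addnC iterD; congr (iter _ g _).
by elim: (i %/ m)%N => //= q IH; rewrite mulSn iterD IH.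
Qed.

Lemma turn_reaches_next d : d \in l ->
  exists k, next l d = iter k.+1 (@rotation G) (rev d).
Proof.
move=> dl; have : next l d \in porbit (@rotation G) (rev d).
  by rewrite rotation_orbit; apply/eqP/next_origin.
(* Exponent zero would mean that the loop turns back along the edge of [d]; this is excluded, so at
   least one rotation is made. *)
case/porbitP => -[|k]; rewrite permX => E; last by exists k.
have : rev d \in l by rewrite -[rev d]/(iter 0 (@rotation G) (rev d)) -E mem_next.
by rewrite (negPf (loop_rev dl)).
Qed.

Lemma iter_rotation_origin k (d : dart G) : origin (iter k (@rotation G) d) = origin d.
Proof. by elim: k => //= k; rewrite rotation_origin. Qed.

(** A simple loop uses only two darts at [target d], namely [d] arriving and [next l d] leaving. A
    rotation that has not yet met the second cannot have come back to the first. *)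
Lemma turn_off_loop d j : d \in l ->
  (forall i, (i <= j)%N -> iter i.+1 (@rotation G) (rev d) != next l d) ->
  let b := iter j.+1 (@rotation G) (rev d) in b \notin l /\ rev b \notin l.
Proof.
move=> dl nohit b; have ob : origin b = target d by rewrite /b iter_rotation_origin.
split; apply/negP => bl.
  have /eqP : b = next l d by apply: origin_inj; rewrite ?mem_next // next_origin.
  by rewrite (negPf (nohit j (leqnn j))).
have : next l (rev b) = next l d.
  apply: origin_inj; rewrite ?mem_next // !next_origin //.
  by rewrite /target revK.
move=> /(congr1 (prev l)); rewrite !prev_next ?loop_uniq // => Ebd.
(* Here the turn is complete, so every dart at this vertex, including [next l d], has occurred
   within the first [j.+1] rotations. *)
have per : iter j.+1 (@rotation G) (rev d) = rev d by rewrite -/b -{1}(revK b) Ebd.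
have [k Ek] := turn_reaches_next dl.
have : (k.+1 %% j.+1 < j.+1)%N by rewrite ltn_mod.
move: (iter_period k.+1 per); rewrite -Ek; case: (k.+1 %% j.+1)%N => [|m] Em mj.
  have : rev d \in l by rewrite -[rev d]/(iter 0 (@rotation G) (rev d)) -Em mem_next.
  by rewrite (negPf (loop_rev dl)).
by have := nohit m (ltnW mj); rewrite Em eqxx.
Qed.

Variable h : face G -> int.
Hypothesis hl : forall d, coboundary h d = flow l d.

Lemma potential_off d : d \notin l -> rev d \notin l ->
  h (left_face d) = h (right_face d).
Proof. by move=> dl rl; apply/eqP; rewrite -subr_eq0 -/(coboundary h d) hl flow_off. Qed.

(** The sweep starts in the face on the right of [d], and each dart passed is off the loop, so [h]
    keeps its value across it. *)
Lemma potential_corner d j : d \in l ->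
  (forall i, (i <= j)%N -> iter i.+1 (@rotation G) (rev d) != next l d) ->
  h (left_face (iter j.+1 (@rotation G) (rev d))) = h (right_face d).
Proof.
move=> dl; elim: j => [|j IH] nohit.
  have [b1 b2] := turn_off_loop dl nohit.
  by rewrite potential_off // right_face_rotation.
have [b1 b2] := turn_off_loop dl nohit.
rewrite potential_off // [iter j.+2 _ _]iterS right_face_rotation IH // => i ij.
by apply: nohit; rewrite ltnW.
Qed.

Lemma potential_next d : d \in l -> h (right_face (next l d)) = h (right_face d).
Proof.
move=> dl; have [k0 Ek0] := turn_reaches_next dl.
have ex : exists k, iter k.+1 (@rotation G) (rev d) == next l d by exists k0; rewrite Ek0.
have [k /eqP Ek kmin] := ex_minnP ex.
rewrite -Ek iterS right_face_rotation.
case: k Ek kmin => // k Ek kmin; apply: potential_corner => // i ik.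
by apply/negP => /kmin; rewrite ltnNge ik.
Qed.

(** Local constancy at each corner propagates around the cycle, so that each side of the loop
    carries one value of [h]. *)
Lemma potential_right d d' : d \in l -> d' \in l ->
  h (right_face d) = h (right_face d').
Proof.
move=> dl dl'; pose r := fun a b : dart G => h (right_face a) == h (right_face b).
have  : path.cycle r l.
  apply: cycle_from_next loop_uniq _ => a al.
  by rewrite /r potential_next.
rewrite cycle_all2rel; last by move=> a b c /eqP ba /eqP ac; rewrite /r ba ac.
by move=> /allrelP/(_ _ _ dl dl')/eqP.
Qed.

Lemma potential_left d : d \in l -> h (left_face d) = h (right_face d) + 1.
Proof. by move=> dl; rewrite -(flow_loop dl) -hl /coboundary addrC subrK. Qed.

End Loops.

Section LoopOrientation.
Variables (G : planeGraph) (l : seq (dart G)).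
Hypothesis loop : simple_loop l.

(** Otherwise being connected to the outer face off [l] would be false on both sides of each loop
    edge and unchanged across the other edges; by [face_const] it would then be constant, yet it
    holds at the outer face. *)
Lemma loop_reaches_outer : exists2 d, d \in l &
  ~~ encloses l (left_face d) \/ ~~ encloses l (right_face d).
Proof.
apply: contrapT => noexit.
pose H f := connect (dual_adjacent_off l) f (outer G).
have offE d : d \notin l -> rev d \notin l -> H (left_face d) = H (right_face d).
  move=> dl rl; apply/idP/idP; apply/connect_trans/connect1/existsP.
    by exists (rev d); rewrite revK dl rl /right_face revK !eqxx.
  by exists d; rewrite dl rl !eqxx.
have onE d : d \in l -> H (left_face d) = false /\ H (right_face d) = false.
  move=> dl; split; apply/negbTE/negP => Hd; apply: noexit; exists d => //.
    by left; rewrite negbK.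
  by right; rewrite negbK.
have Hc := face_const (@plane_connected G) (h := H).
have [d dl] : exists d, d \in l.
  by case/and4P: loop; case: (l) => // d p _ _ _ _; exists d; rewrite mem_head.
have : H (left_face d) = H (outer G).
  apply: Hc => b; have [/onE[-> ->] //|bl] := boolP (b \in l).
  have [/onE[]|] := boolP (rev b \in l); last exact: offE.
  by rewrite /right_face revK => -> ->.
by case: (onE d dl) => -> _; rewrite /H connect0.
Qed.

Lemma potential_exterior (h : face G -> int) f :
  (forall d, coboundary h d = flow l d) -> ~~ encloses l f -> h f = h (outer G).
Proof.
move=> hl; rewrite negbK => /connectP[p].
elim: p f => [|f' p IH] f /= => [_ -> //|/andP[/existsP[d /and4P[dl rl /eqP <- /eqP Ed]] pp] Eo].
by rewrite (potential_off hl dl rl) Ed; apply: IH.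
Qed.

(** Some side of the loop touches the exterior, where [h = 0]. A counterclockwise loop has the
    exterior on its right, whence [h0 = 0]; a clockwise one has it on its left, whence
    [h0 + 1 = 0]. *)
Lemma loop_potential : exists (h : face G -> int) (h0 : int),
  [/\ h (outer G) = 0, forall d, coboundary h d = flow l d,
      forall d, d \in l -> h (right_face d) = h0 /\ h (left_face d) = h0 + 1,
      counterclockwise l -> h0 = 0 & clockwise l -> h0 = -1].
Proof.
have [h [h_out hE]] := divergence_free_coboundary (divergence_loop loop).
have hl d : coboundary h d = flow l d.
  case: d => a []; first by rewrite hE.
  by rewrite -[(a, false)]/(rev (a, true)) coboundary_rev flow_rev hE.
have [d dl exd] := loop_reaches_outer.
exists h, (h (right_face d)); split=> // [d' dl'|/allP/(_ d dl) cc|/allP/(_ d dl) cw].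
- by rewrite (potential_left loop hl dl') (potential_right loop hl dl' dl).
- case: exd; first by rewrite cc.
  by move=> /(potential_exterior hl) ->.
- case: exd; last by rewrite cw.
  move=> /(potential_exterior hl); rewrite h_out (potential_left loop hl dl); lia.
Qed.

End LoopOrientation.

Lemma half_gtE (k z : int) : (z%:~R < k%:~R + 2^-1 :> rat) = (z <= k).
Proof.
apply/idP/idP => [|zk]; last first.
  have : (z%:~R <= k%:~R :> rat) by rewrite ler_int.
  by lra.
apply: contraLR; rewrite -ltNge -leNgt -lezD1 => kz.
have : ((k + 1)%:~R <= z%:~R :> rat) by rewrite ler_int.
by rewrite rmorphD /=; lra.
Qed.

Lemma half_ltE (k z : int) : (k%:~R + 2^-1 < z%:~R :> rat) = (k + 1 <= z).
Proof.
apply/idP/idP => [|kz]; last first.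
  have : ((k + 1)%:~R <= z%:~R :> rat) by rewrite ler_int.
  by rewrite rmorphD /=; lra.
apply: contraLR; rewrite -ltNge -leNgt ltzD1 => zk.
have : (z%:~R <= k%:~R :> rat) by rewrite ler_int.
by lra.
Qed.

(** * Level lines and the right-hand rule *)

Section Contours.
Variable G : planeGraph.
Implicit Types (n : height G) (q : rat) (d : dart G) (s : seq (dart G)).

Lemma continued_by_origin n q d d' : continued_by n q d d' -> origin d' = target d.
Proof. by case=> k [-> _ _]; rewrite iter_rotation_origin. Qed.

Lemma continued_by_fun n q d d1 d2 :
  continued_by n q d d1 -> continued_by n q d d2 -> d1 = d2.
Proof.
move=> [k1 [E1 q1 m1]] [k2 [E2 q2 m2]]; case: (ltngtP k1 k2) => [k12|k21|E].
- by have := m2 _ k12; rewrite -E1 q1.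
- by have := m1 _ k21; rewrite -E2 q2.
- by rewrite E1 E2 E.
Qed.

Lemma contour_prefix n q d s s' : contour_from n q d s -> contour_from n q d s' ->
  (size s <= size s')%N -> s = take (size s) s'.
Proof.
elim: s s' d => [|d1 s IH] [|d2 s'] d //=.
move=> [c1 cs] [c2 cs']; rewrite ltnS => ss'.
have E := continued_by_fun c1 c2; rewrite -E in cs' *.
by rewrite -(IH s' d1).
Qed.

(* the faces inspected while following the contour [d :: s] by the right-hand rule *)
Fixpoint scanned d s (f : face G) : Prop :=
  [\/ f = left_face d, f = right_face d |
      if s is d' :: s' then
        (exists2 j, forall i, (i <= j)%N -> iter i.+1 (@rotation G) (rev d) != d' &
           f = left_face (iter j.+1 (@rotation G) (rev d)))
        \/ scanned d' s' f
      else False].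

Lemma scanned_left d s : scanned d s (left_face d).
Proof. by case: s => [|d' s]; constructor 1. Qed.

Lemma scanned_right d s : scanned d s (right_face d).
Proof. by case: s => [|d' s]; constructor 2. Qed.

Lemma scanned_behead d d' s f : scanned d' s f -> scanned d (d' :: s) f.
Proof. by move=> H; constructor 3; right. Qed.

Lemma scanned_mem d s d' : d' \in d :: s ->
  scanned d s (left_face d') /\ scanned d s (right_face d').
Proof.
elim: s d => [|b s IH] d; rewrite in_cons => /predU1P[->|].
- by split; [exact: scanned_left|exact: scanned_right].
- by [].
- by split; [exact: scanned_left|exact: scanned_right].
- by move=> /IH[? ?]; split; exact: scanned_behead.
Qed.

Lemma turn_nohit n q d d' k j :
  d' = iter k.+1 (@rotation G) (rev d) -> q_edge n q d' ->
  (forall j, (j < k)%N -> ~~ q_edge n q (iter j.+1 (@rotation G) (rev d))) ->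
  (j < k)%N -> forall i, (i <= j)%N -> iter i.+1 (@rotation G) (rev d) != d'.
Proof.
move=> _ qd' noq jk i ij; apply/eqP => E.
by have := noq i (leq_ltn_trans ij jk); rewrite E qd'.
Qed.

Lemma q_path_local n n' q d s : q_path n q d s ->
  (forall f, scanned d s f -> n' f = n f) -> q_path n' q d s.
Proof.
case=> qd cd agr; have qd' : q_edge n' q d.
  by rewrite /q_edge !agr //; [exact: scanned_left|exact: scanned_right].
split=> //; elim: s d qd cd agr {qd'} => //= d' s IH d qd [cd cs] agr.
have [k [Ek qd' noq]] := cd.
split; last first.
  by apply: IH => // f fs; apply/agr/scanned_behead.
exists k; split=> //.
  rewrite /q_edge !agr //; last by apply: scanned_behead; exact: scanned_right.
  by apply: scanned_behead; exact: scanned_left.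
move=> j jk; have nohit := turn_nohit Ek qd' noq.
have := noq j jk; rewrite /q_edge agr; last first.
  (* The right face of a rejected dart is the left face of the previous one, or the right face of
     [d] when the sweep starts, so both its sides are inspected. *)
  case: j jk => [|j] jk; rewrite right_face_rotation.
    exact: (@scanned_right d (d' :: s)).
  by constructor 3; left; exists j => //; apply: nohit; exact: ltnW.
by rewrite agr //; constructor 3; left; exists j => //; apply: nohit.
Qed.

Lemma contour_walk n q d s : contour_from n q d s ->
  is_walk (origin d) (target (last d s)) (d :: s).
Proof.
elim: s d => [|d' s IH] d /=; first by rewrite !eqxx.
move=> [/continued_by_origin E /IH /=]; rewrite eqxx /= => ->.
by rewrite eqxx E eqxx.
Qed.

Variables (k : int) (l : seq (dart G)) (h : face G -> int) (h0 : int).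
Hypothesis loop : simple_loop l.
Hypothesis hl : forall d, coboundary h d = flow l d.
Hypothesis h_l : forall d, d \in l -> h (right_face d) = h0 /\ h (left_face d) = h0 + 1.

(** The point of the right-hand rule: the faces swept at a corner are all below [q] and all on the
    right of the loop. Thus on inspected faces [h - h0] is the indicator of [n > q]. *)
Lemma scanned_sides n d s :
  q_path n (k%:~R + 2^-1) d s -> {subset d :: s <= l} -> forall f, scanned d s f ->
  k + 1 <= n f /\ h f = h0 + 1 \/ n f <= k /\ h f = h0.
Proof.
case; elim: s d => [|d' s IH] d qd cs sl f.
  have [hr hle] := h_l (sl d (mem_head _ _)).
  move: qd; rewrite /q_edge half_gtE half_ltE => /andP[nr nl].
  by case=> [->|->|//]; [left|right].
have dl := sl d (mem_head _ _); have [hr hle] := h_l dl.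
move: cs => /= [cd cs]; have [m [Em qd' noq]] := cd.
(* The loop leaves each vertex once, so its successor of [d] must be the continuation of the
   contour. *)
have nextd : next l d = d'.
  apply: (origin_inj loop); rewrite ?mem_next ?next_origin //.
    by apply: sl; rewrite !inE eqxx orbT.
  by rewrite (continued_by_origin cd).
move: (qd); rewrite /q_edge half_gtE half_ltE => /andP[nr nl].
case=> [->|->|[[j nohit ->]|]]; [by left|by right| |]; last first.
  apply: (IH d' qd' cs) => b bs; apply: sl.
  by rewrite inE bs orbT.
right; split; last by rewrite (potential_corner loop hl dl) ?nextd.
have jm : (j < m)%N by rewrite ltnNge; apply/negP => mj; have := nohit m mj; rewrite -iterS -Em eqxx.
(* A rejected dart with its right face below [q] has its left face below [q] as well, or it would be
   a [q]-edge. *)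
elim: j jm {nohit} => [|j IHj] jm.
  have := noq 0%N jm; rewrite /q_edge right_face_rotation half_gtE half_ltE.
  by rewrite -[left_face (iter 0 _ _)]/(right_face d) nr /=; lia.
have := noq _ jm; rewrite /q_edge right_face_rotation half_gtE half_ltE.
by rewrite IHj /=; [lia|exact: ltnW].
Qed.

End Contours.

Lemma half_integer_neq0 (k : int) : k%:~R + 2^-1 != 0 :> rat.
Proof.
apply/eqP => E; have : (0%:~R < k%:~R + 2^-1 :> rat) = (0%:~R < 0 :> rat) by rewrite E.
have : (k%:~R + 2^-1 < 0%:~R :> rat) = (0 < 0%:~R :> rat) by rewrite E.
by rewrite half_ltE half_gtE !ltxx; lia.
Qed.

Section Event.
Variables (G : planeGraph) (y : vertex G) (gamma : seq (dart G)) (e : dart G).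

Definition A_contour (q : rat) (n : height G) (s : seq (dart G)) : Prop :=
  [/\ q_path n q e s, target (last e s) = y, simple_loop (gamma ++ e :: s) &
      has_orientation_sgn q (gamma ++ e :: s)].

(** The outer face is pinned along with the inspected ones, so that the Dirichlet condition is also
    decided by pinned values. *)
Definition fixed_faces (s : seq (dart G)) : {set face G} :=
  [set f | `[< scanned e s f \/ f = outer G >]].

Lemma A_contour_local q (n n' : height G) s : A_contour q n s ->
  {in fixed_faces s, forall f, n' f = n f} -> A_contour q n' s.
Proof.
case=> qp ? ? ? agr; split=> //; apply: q_path_local qp _ => f fs.
by apply: agr; rewrite inE; apply/asboolP; left.
Qed.

(** At the outer face both [n] and [h] vanish, so the dichotomy asks for [h0 = 0] with [0 <= k], or
    [h0 = -1] with [k + 1 <= 0]. These are the counterclockwise case with [q > 0] and the clockwise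
    case with [q < 0]. *)
Lemma A_contour_potential q n s : half_integer q -> dirichlet n ->
  A_contour q n s ->
  exists (k h0 : int) (h : face G -> int),
  [/\ h (outer G) = 0, forall d, coboundary h d = flow gamma d + flow (e :: s) d &
      {in fixed_faces s, forall f,
        k + 1 <= n f /\ h f = h0 + 1 \/ n f <= k /\ h f = h0}].
Proof.
move=> [k Eq] n0 [qp ls loop orient]; rewrite {}Eq in qp orient.
have [h [h0 [h_out hl h_l ccw cw]]] := loop_potential loop.
exists k, h0, h; split=> //; first by move=> d; rewrite hl flow_cat.
move=> f; rewrite inE => /asboolP[fs|->].
  apply: (scanned_sides loop hl h_l qp _ fs) => d ds.
  by rewrite mem_cat ds orbT.
rewrite n0 h_out; move: orient; rewrite /has_orientation_sgn.
case: ifPn => [kpos /ccw ->|]; first by right; move: kpos; rewrite -[0]/(0%:~R) half_gtE.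
rewrite -leNgt le_eqVlt (negPf (half_integer_neq0 k)) /= => kneg /cw ->.
by left; move: kneg; rewrite -[X in _ < X]/(0%:~R) half_ltE; lia.
Qed.

Variable x : vertex G.
Hypothesis neq_xy : x <> y.
Hypothesis gamma_path : simple_path y x gamma.

Let gamma_head : exists d p, gamma = d :: p /\ origin d = y.
Proof.
case/andP: gamma_path; case: gamma => [/eqP/esym //|d p /= /andP[/eqP Ed _] _].
by exists d, p.
Qed.

(** Contours from [e] are prefixes of one another. The longer one would go on through [y], where the
    nonempty path [gamma] already starts, and its loop would visit [y] twice. *)
Lemma A_contour_unique q n s s' : A_contour q n s -> A_contour q n s' -> s = s'.
Proof.
wlog ss' : s s' / (size s <= size s')%N.
  move=> W A1 A2; have [/W|/ltnW/W W'] := leqP (size s) (size s'); first exact.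
  by rewrite (W' A2 A1).
move=> [[_ c1] l1 _ _] [[_ c2] _ /and4P[_ _ uo _] _].
have Es := contour_prefix c1 c2 ss'; rewrite -(cat_take_drop (size s) s') -Es.
case Et : (drop (size s) s') => [|t s'']; first by rewrite cats0.
have Es' : s' = s ++ t :: s'' by rewrite -(cat_take_drop (size s) s') -Es Et.
have ot : origin t = y.
  move: (contour_walk c2); rewrite Es' -l1 /= eqxx /=.
  elim: (s) (e) => [|d p IH] d0 /=; first by move=> /andP[/eqP].
  by move=> /andP[_ /IH].
have [d [p [Eg od]]] := gamma_head.
move: uo; rewrite Es' Eg /= => /andP[/negP[]].
by rewrite od -ot !(map_cat, map_cons, mem_cat, in_cons) eqxx !orbT.
Qed.

End Event.

(** * Integer sums as limits over symmetric boxes *)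

Definition symrange (N : nat) : seq int :=
  map Posz (iota 0 N.+1) ++ map Negz (iota 0 N).

Lemma mem_symrange N (i : int) : (i \in symrange N) = (`|i| <= N)%N.
Proof.
rewrite mem_cat; case: i => n.
  rewrite [in X in X || _](mem_map (f := Posz)); last by move=> a b [].
  rewrite mem_iota ltnS /=.
  rewrite (_ : (Posz n \in _) = false) ?orbF //.
  by apply/negbTE/negP => /mapP[].
rewrite [in X in _ || X](mem_map (f := Negz)); last by move=> a b [].
rewrite mem_iota /= (_ : (Negz n \in _) = false) //.
by apply/negbTE/negP => /mapP[].
Qed.

Lemma uniq_symrange N : uniq (symrange N).
Proof.
rewrite cat_uniq !map_inj_uniq ?iota_uniq //=; try by move=> a b [].
by rewrite andbT; apply/hasPn => _ /mapP[i _ ->]; apply/negP => /mapP[].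
Qed.

Lemma sum_symrange (V : nmodType) (g : int -> V) N :
  \sum_(i <- symrange N) g i = g 0 + \sum_(i < N) (g (Posz i.+1) + g (Negz i)).
Proof.
have iotaE (F : nat -> V) k : \sum_(j <- iota 0 k) F j = \sum_(j < k) F j.
  by rewrite -(big_mkord xpredT F) /index_iota subn0.
rewrite /symrange big_cat !big_map !iotaE /=.
by rewrite big_ord_recl big_split /= addrA.
Qed.

Section Boxes.
Variable T : finType.
Implicit Types (p n m : {ffun T -> int}) (s : seq T).

Definition upd p (v : T) (i : int) : {ffun T -> int} :=
  [ffun u => if u == v then i else p u].

(** Coordinates outside [s] keep the values of [p], which encodes pinning. Recursion on the free
    coordinates lets product formulas and the four functions theorem go by induction on [s]. *)
Fixpoint box s (r : seq int) p : seq {ffun T -> int} :=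
  if s is v :: s' then flatten [seq box s' r (upd p v i) | i <- r] else [:: p].

Lemma mem_box s r p n :
  (n \in box s r p) = [forall u, if u \in s then n u \in r else n u == p u].
Proof.
elim: s p => [|v s IH] p /=.
  rewrite inE; apply/eqP/forallP => [-> //|E].
  by apply/ffunP => u; apply/eqP/E.
apply/flatten_mapP/forallP => [[i ir]|E].
  rewrite IH => /forallP E u; have := E u; rewrite in_cons ffunE.
  by case: (u == v); case: (u \in s) => //= /eqP ->.
exists (n v); first by have := E v; rewrite mem_head.
rewrite IH; apply/forallP => u; have := E u; rewrite in_cons ffunE.
by case: eqP => [->|_] /=; case: (_ \in s); rewrite ?eqxx.
Qed.

Lemma uniq_box s r p : uniq s -> uniq r -> uniq (box s r p).
Proof.
elim: s p => //= v s IH p /andP[vs us] ur.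
suff uflat r' : uniq r' -> uniq (flatten [seq box s r (upd p v i) | i <- r']).
  exact: uflat.
elim: r' => //= i r' IHr /andP[ir' ur'].
rewrite cat_uniq IH // IHr // andbT /=.
apply/hasPn => n /flatten_mapP[j jr']; rewrite mem_box => /forallP/(_ v).
rewrite (negPf vs) ffunE eqxx => /eqP nv.
rewrite mem_box; apply/negP => /forallP/(_ v).
rewrite (negPf vs) ffunE eqxx nv => /eqP E.
by move: ir'; rewrite -E jr'.
Qed.

Lemma box_sum_cons (V : nmodType) (F : {ffun T -> int} -> V) v s r p :
  \sum_(n <- box (v :: s) r p) F n =
  \sum_(i <- r) \sum_(n <- box s r (upd p v i)) F n.
Proof. by rewrite /= big_flatten big_map. Qed.

End Boxes.

(** * The four functions theorem *)

Section FourFunctions.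
Variable R : realFieldType.

(** From [(c - a) * (c - b) >= 0] one gets [c * (a + b) <= c * c + a * b <= c * (c + d)]; then
    divide by [c], the case [c = 0] forcing [a = b = 0]. *)
Lemma add_le_of_mul (a b c d : R) : 0 <= a -> 0 <= b -> 0 <= c -> 0 <= d ->
  a <= c -> b <= c -> a * b <= c * d -> a + b <= c + d.
Proof.
move=> a0 b0 c0 d0 ac bc abcd.
have [c1|c1|c1] := ltrgtP c 0; [lra| |lra].
rewrite -(ler_pM2l c1); nra.
Qed.

(** After symmetrization it suffices to treat each pair [j <= i]. Both terms on the left are at most
    [f3 i * f4 j], and the hypothesis on the diagonal at [i] and at [j] bounds their product, so
    [add_le_of_mul] applies. *)
Lemma four_functions_seq (f1 f2 f3 f4 : int -> R) (r : seq int) :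
  (forall i, 0 <= f1 i) -> (forall i, 0 <= f2 i) ->
  (forall i, 0 <= f3 i) -> (forall i, 0 <= f4 i) ->
  (forall i j, f1 i * f2 j <= f3 (Num.max i j) * f4 (Num.min i j)) ->
  (\sum_(i <- r) f1 i) * (\sum_(i <- r) f2 i) <=
  (\sum_(i <- r) f3 i) * (\sum_(i <- r) f4 i).
Proof.
move=> p1 p2 p3 p4 H.
have prodE (f g : int -> R) : (\sum_(i <- r) f i) * (\sum_(i <- r) g i) =
    2^-1 * \sum_(i <- r) \sum_(j <- r) (f i * g j + f j * g i).
  have E1 : (\sum_(i <- r) f i) * (\sum_(i <- r) g i) =
      \sum_(i <- r) \sum_(j <- r) f i * g j.
    by rewrite mulr_suml; apply: eq_bigr => i _; rewrite mulr_sumr.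
  have E2 : \sum_(i <- r) \sum_(j <- r) (f i * g j + f j * g i) =
      (\sum_(i <- r) \sum_(j <- r) f i * g j) + (\sum_(i <- r) \sum_(j <- r) f i * g j).
    under eq_bigr do rewrite big_split /=.
    by rewrite big_split /=; congr (_ + _); rewrite exchange_big.
  by rewrite E2 E1; field.
rewrite !prodE ler_pM2l ?invr_gt0 ?ltr0n //.
apply: ler_sum => i _; apply: ler_sum => j _.
wlog ij : i j / j <= i.
  move=> W; have [/W //|/ltW/W] := leP j i.
  by rewrite addrC [X in _ <= X]addrC.
have := H i j; have := H j i.
rewrite (max_l ij) (max_r ij) (min_l ij) (min_r ij) => Hji Hij.
apply: add_le_of_mul; rewrite ?mulr_ge0 //.
have := H i i; have := H j j; rewrite !maxxx !minxx => Hjj Hii.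
have := ler_pM (mulr_ge0 (p1 i) (p2 i)) (mulr_ge0 (p1 j) (p2 j)) Hii Hjj.
by congr (_ <= _); ring.
Qed.

Variable T : finType.
Implicit Types n m p q : {ffun T -> int}.

Definition ffun_max n m : {ffun T -> int} := [ffun t => Num.max (n t) (m t)].
Definition ffun_min n m : {ffun T -> int} := [ffun t => Num.min (n t) (m t)].

(** By the induction hypothesis, the sums over the remaining coordinates, as functions of the value
    at [v], again satisfy the hypothesis on a chain. *)
Lemma four_functions_box (F1 F2 F3 F4 : {ffun T -> int} -> R) s r :
  (forall n, 0 <= F1 n) -> (forall n, 0 <= F2 n) ->
  (forall n, 0 <= F3 n) -> (forall n, 0 <= F4 n) ->
  (forall n m, F1 n * F2 m <= F3 (ffun_max n m) * F4 (ffun_min n m)) ->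
  forall p q, (\sum_(n <- box s r p) F1 n) * (\sum_(n <- box s r q) F2 n) <=
    (\sum_(n <- box s r (ffun_max p q)) F3 n) *
    (\sum_(n <- box s r (ffun_min p q)) F4 n).
Proof.
move=> p1 p2 p3 p4 H; elim: s => [|v s IH] p q; first by rewrite !big_seq1.
rewrite !box_sum_cons; apply: four_functions_seq => [i|i|i|i|i j].
- by apply: sumr_ge0 => n _.
- by apply: sumr_ge0 => n _.
- by apply: sumr_ge0 => n _.
- by apply: sumr_ge0 => n _.
apply: le_trans (IH _ _) _.
rewrite (_ : ffun_max _ _ = upd (ffun_max p q) v (Num.max i j)); last first.
  by apply/ffunP => t; rewrite !ffunE; case: eqP.
rewrite (_ : ffun_min _ _ = upd (ffun_min p q) v (Num.min i j)) //.
by apply/ffunP => t; rewrite !ffunE; case: eqP.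
Qed.

End FourFunctions.

Section BoxLimits.
Variables (R : realType) (T : finType).
Implicit Types (a : {ffun T -> int} -> R) (p n : {ffun T -> int}).

Definition pinned (s : seq T) p : set {ffun T -> int} :=
  [set n | forall u, u \notin s -> n u = p u].

Lemma box_pinned s N p n : n \in box s (symrange N) p -> pinned s p n.
Proof.
rewrite mem_box => /forallP nb u us; have := nb u.
by rewrite (negPf us) => /eqP.
Qed.

Lemma pinned_box s p n : pinned s p n ->
  exists N0, forall N, (N0 <= N)%N -> n \in box s (symrange N) p.
Proof.
move=> np; exists (\max_(u : T) `|n u|%N) => N NN.
rewrite mem_box; apply/forallP => u; case: ifPn => [us|/np -> //].
by rewrite mem_symrange; apply: leq_trans NN; apply: (leq_bigmax u).
Qed.

Lemma finite_exhaustion (U : choiceType) (D : set U) (L : nat -> seq U) (X : set U) :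
  (forall t, D t -> exists N0, forall N, (N0 <= N)%N -> t \in L N) ->
  finite_set X -> X `<=` D ->
  exists N0, forall N, (N0 <= N)%N -> X `<=` [set` L N].
Proof.
move=> exh /finite_seqP[l ->] lD.
have [f fP] := choice (fun t : {t | t \in l} => exh (sval t) (lD _ (svalP t))).
pose g t := if pselect (t \in l) is left tl then f (exist _ t tl) else 0%N.
exists (\max_(t <- l) g t) => N NN t tl /=.
have := fP (exist _ t tl) N; apply; apply: leq_trans NN.
have -> : f (exist _ t tl) = g t.
  rewrite /g; case: pselect => [tl'|//]; congr (f (exist _ _ _)).
  exact: bool_irrelevance.
exact: leq_bigmax_seq.
Qed.

Lemma sum_uniq_le_esum (U : choiceType) (D : set U) (b : U -> R) (L : seq U) :
  uniq L -> (forall t, t \in L -> D t) ->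
  ((\sum_(t <- L) b t)%:E <= \esum_(t in D) (b t)%:E)%E.
Proof.
move=> uL LD; apply: esum_ge; exists [set` L].
  by split; [exact: finite_seq|move=> n /= /LD].
by rewrite -fsbig_seq // sumEFin.
Qed.

(** The bridge between unordered sums and limits of finite ones; the uniform bound [C] keeps the
    extended sum finite, so that [fine] loses nothing. *)
Lemma exhaustion_sum_cvg (U : choiceType) (D : set U) (L : nat -> seq U)
    (b : U -> R) (C : R) :
  (forall N, uniq (L N)) -> (forall N t, t \in L N -> D t) ->
  (forall t, D t -> exists N0, forall N, (N0 <= N)%N -> t \in L N) ->
  (forall t, 0 <= b t) -> (forall N, \sum_(t <- L N) b t <= C) ->
  (\esum_(t in D) (b t)%:E < +oo)%E /\
  \sum_(t <- L N) b t @[N --> \oo] --> fine (\esum_(t in D) (b t)%:E)%E.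
Proof.
move=> uL LD exh b0 bC.
have setsum X N : finite_set X -> X `<=` [set` L N] ->
    (\sum_(t \in X) (b t)%:E <= (\sum_(t <- L N) b t)%:E)%E.
  move=> Xf XL; rewrite -sumEFin (fsbig_seq _ _ (uL N)).
  apply: lee_fsum_nneg_subset => //.
    by move=> t /set_mem/XL tL; apply/mem_set.
  by move=> t _; rewrite lee_fin.
have bound : (\esum_(t in D) (b t)%:E <= C%:E)%E.
  apply: ge_ereal_sup => _ /= [X [Xf XD] <-].
  have [N0 /(_ N0 (leqnn _)) XN] := finite_exhaustion exh Xf XD.
  by apply: le_trans (setsum _ _ Xf XN) _; rewrite lee_fin.
have finE : (\esum_(t in D) (b t)%:E)%E \is a fin_num.
  rewrite ge0_fin_numE ?esum_ge0 //; first by apply: le_lt_trans bound _; rewrite ltry.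
  by move=> t _; rewrite lee_fin.
split; first by rewrite -ge0_fin_numE // esum_ge0 // => t _; rewrite lee_fin.
apply/cvgrPdist_le => eps eps0.
have [_ [X [Xf XD] <-] XE] := ub_ereal_sup_adherent eps0 finE.
have [N0 XN] := finite_exhaustion exh Xf XD.
near=> N; rewrite ger0_norm ?subr_ge0; last first.
  by rewrite -lee_fin fineK //; apply: sum_uniq_le_esum => // t; exact: LD.
have NN0 : (N0 <= N)%N by near: N; exists N0.
rewrite lerBlDr -lerBlDl -lee_fin EFinB fineK //.
by apply: le_trans (ltW XE) _; exact: setsum Xf (XN _ NN0).
Unshelve. all: by end_near.
Qed.

Lemma box_sum_cvg s p a (C : R) : uniq s -> (forall n, 0 <= a n) ->
  (forall N, \sum_(n <- box s (symrange N) p) a n <= C) ->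
  (\esum_(n in pinned s p) (a n)%:E < +oo)%E /\
  \sum_(n <- box s (symrange N) p) a n @[N --> \oo]
    --> fine (\esum_(n in pinned s p) (a n)%:E)%E.
Proof.
move=> us; apply: exhaustion_sum_cvg.
- by move=> N; rewrite uniq_box ?uniq_symrange.
- by move=> N n; exact: box_pinned.
- by move=> n; exact: pinned_box.
Qed.

End BoxLimits.

Lemma ler_sum_subset (R : numDomainType) (U : eqType) (L L' : seq U) (b : U -> R) :
  uniq L -> uniq L' -> {subset L <= L'} -> (forall t, 0 <= b t) ->
  \sum_(t <- L) b t <= \sum_(t <- L') b t.
Proof.
move=> uL uL' LL' b0; rewrite [leRHS](bigID (mem L)) /=.
have -> : \sum_(t <- L' | t \in L) b t = \sum_(t <- L) b t.
  rewrite -big_filter; apply/perm_big/uniq_perm => //; first exact: filter_uniq.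
  by move=> t; rewrite mem_filter; case: (boolP (t \in L)) => //= /LL' ->.
by rewrite lerDl sumr_ge0.
Qed.

(** Both [w - b] and [w + b] are nonnegative, so their sums increase with the list. This is the
    domination that makes later approximations uniform in the angle. *)
Lemma ler_norm_sum_tail (R : realDomainType) (U : eqType) (L L' : seq U) (b w : U -> R) :
  uniq L -> uniq L' -> {subset L <= L'} -> (forall t, - w t <= b t <= w t) ->
  `|\sum_(t <- L') b t - \sum_(t <- L) b t| <=
  \sum_(t <- L') w t - \sum_(t <- L) w t.
Proof.
move=> uL uL' LL' bw.
have H1 := @ler_sum_subset _ _ L L' (fun t => w t - b t) uL uL' LL'.
have H2 := @ler_sum_subset _ _ L L' (fun t => w t + b t) uL uL' LL'.
rewrite !sumrB in H1; rewrite !big_split /= in H2.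
have {}H1 : \sum_(t <- L) w t - \sum_(t <- L) b t <= \sum_(t <- L') w t - \sum_(t <- L') b t.
  by apply: H1 => t; have /andP[_] := bw t; rewrite subr_ge0.
have {}H2 : \sum_(t <- L) w t + \sum_(t <- L) b t <= \sum_(t <- L') w t + \sum_(t <- L') b t.
  by apply: H2 => t; have /andP[+ _] := bw t; lra.
by rewrite ler_norml; lra.
Qed.

Section BoxProducts.
Variables (R : realType) (T : finType) (alpha : int -> R).
Hypothesis alpha_even : forall i, alpha (- i) = alpha i.

Lemma sum_symrange_sin N (t : R) :
  \sum_(i <- symrange N) alpha i * sin (i%:~R * t) = 0.
Proof.
rewrite sum_symrange mul0r sin0 mulr0 add0r big1 // => i _.
by rewrite NegzE alpha_even mulrNz mulNr sinN mulrN subrr.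
Qed.

(** Real form of the factorization of characters: expanding the cosine one coordinate at a time, the
    sine parts are odd and cancel over the symmetric range. *)
Lemma box_prod_cos (t : T -> R) s N (p : {ffun T -> int}) A : uniq s ->
  \sum_(n <- box s (symrange N) p)
    (\prod_(v <- s) alpha (n v)) * cos (A + \sum_(v <- s) (n v)%:~R * t v) =
  (\prod_(v <- s) \sum_(i <- symrange N) alpha i * cos (i%:~R * t v)) * cos A.
Proof.
elim: s p A => [|v s IH] p A.
  by rewrite /= !big_seq1 !big_nil addr0.
move=> /andP[vs us]; rewrite box_sum_cons big_cons.
set C := \prod_(_ <- _) _.
transitivity (\sum_(i <- symrange N) alpha i * (C * cos (A + i%:~R * t v))).
  apply: eq_bigr => i _; rewrite -(IH (upd p v i)) // mulr_sumr.
  rewrite big_seq [RHS]big_seq; apply: eq_bigr => n.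
  rewrite mem_box => /forallP/(_ v); rewrite (negPf vs) ffunE eqxx => /eqP nv.
  by rewrite !big_cons nv addrA mulrA.
under eq_bigr do rewrite cosD.
rewrite (eq_bigr (fun i => (alpha i * cos (i%:~R * t v)) * (cos A * C)
   - (alpha i * sin (i%:~R * t v)) * (sin A * C))); last by move=> i _; ring.
by rewrite sumrB -!mulr_suml sum_symrange_sin mul0r subr0; ring.
Qed.

Lemma box_prod s N (p : {ffun T -> int}) : uniq s ->
  \sum_(n <- box s (symrange N) p) \prod_(v <- s) alpha (n v) =
  \prod_(v <- s) \sum_(i <- symrange N) alpha i.
Proof.
move=> us; pose t0 (v : T) : R := 0.
transitivity (\sum_(n <- box s (symrange N) p) (\prod_(v <- s) alpha (n v)) *
    cos (0 + \sum_(v <- s) (n v)%:~R * t0 v)).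
  apply: eq_bigr => n _; rewrite [X in cos (0 + X)]big1 ?addr0 ?cos0 ?mulr1 // => v _.
  by rewrite /t0 mulr0.
rewrite box_prod_cos // cos0 mulr1; apply: eq_bigr => v _; apply: eq_bigr => i _.
by rewrite /t0 mulr0 cos0 mulr1.
Qed.

End BoxProducts.

(** * Gaussian partition functions with pinned heights *)

Section GaussianSums.
Variable R : realType.

Definition gauss_int (c : R) (i : int) : R := expR (- c * i%:~R ^+ 2).

Lemma gauss_int_even c i : gauss_int c (- i) = gauss_int c i.
Proof. by rewrite /gauss_int mulrNz sqrrN. Qed.

Lemma gauss_int_ge0 c i : 0 <= gauss_int c i.
Proof. exact: expR_ge0. Qed.

Lemma gauss_int_bounded c : 0 < c ->
  exists B, forall N, \sum_(i <- symrange N) gauss_int c i <= B.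
Proof.
(* The 1 is the term at zero. Since [i <= (i + 1) ^ 2], the two terms at distance [i + 1] are at
   most [2 * expR (- c) ^+ i], a geometric series. *)
move=> c0; exists (1 + 2 * (1 - expR (- c))^-1) => N.
have e1 : expR (- c) < 1 by rewrite expR_lt1 oppr_lt0.
rewrite sum_symrange /gauss_int expr0n mulr0 expR0 lerD2l.
apply: (@le_trans _ _ (\sum_(i < N) 2 * expR (- c) ^+ i)).
  apply: ler_sum => i _; rewrite NegzE mulrNz sqrrN -mulr2n -[leLHS]mulr_natl.
  rewrite ler_pM2l // -expRM_natl ler_expR.
  have : (i%:R : R) <= i.+1%:~R ^+ 2.
    by rewrite -[i.+1%:~R]/(i.+1%:R) -natrX ler_nat expnS expn1; nia.
  by nra.
rewrite -mulr_sumr ler_pM2l //.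
have := @subrXX R 1 (expR (- c)) N; rewrite expr1n.
under eq_bigr do rewrite expr1n mul1r.
move=> E; rewrite -[leRHS]mul1r ler_pdivlMr ?subr_gt0 // mulrC -E.
by rewrite lerBlDr lerDl exprn_ge0 // expR_ge0.
Qed.

End GaussianSums.

Section Gradients.
Variable G : planeGraph.
Implicit Types (n m : height G) (g : edge G -> int).

Definition gradient g n : {ffun edge G -> int} :=
  [ffun a => coboundary n (a, true) - g a].

Lemma gradient_inj g n m : n (outer G) = m (outer G) ->
  gradient g n = gradient g m -> n = m.
Proof.
move=> out /ffunP nm; apply/ffunP => f; apply/eqP; rewrite -subr_eq0.
have <- : n (outer G) - m (outer G) = 0 by rewrite out subrr.
apply/eqP; apply: (face_const (@plane_connected G) (h := fun f => n f - m f)) => d.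
have cobE d' : coboundary n d' = coboundary m d'.
  case: d' => a [].
    by have := nm a; rewrite !ffunE => /(congr1 (+%R^~ (g a))); rewrite !subrK.
  rewrite -[(a, false)]/(rev (a, true)) !coboundary_rev; congr (- _).
  by have := nm a; rewrite !ffunE => /(congr1 (+%R^~ (g a))); rewrite !subrK.
by have := cobE d; rewrite /coboundary; lia.
Qed.

End Gradients.

Section GradientWeights.
Variables (R : realType) (G : planeGraph) (lam : R).
Hypothesis lam_gt0 : 0 < lam.
Implicit Types (n m p : height G) (K : pred (edge G)) (g : edge G -> int).

Definition gradient_weight K g n : R :=
  expR (- (lam / 2) *
    \sum_(a | K a) ((coboundary n (a, true) - g a)%:~R) ^+ 2).

Lemma gradient_weight_gt0 K g n : 0 < gradient_weight K g n.
Proof. exact: expR_gt0. Qed.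

Lemma gradient_weight_ge0 K g n : 0 <= gradient_weight K g n.
Proof. exact: expR_ge0. Qed.

Lemma gradient_weight_prod g n :
  gradient_weight predT g n = \prod_(a <- enum (edge G)) gauss_int (lam / 2) (gradient g n a).
Proof.
rewrite big_enum /= /gradient_weight mulr_sumr expR_sum.
by apply: eq_bigr => a _; rewrite /gauss_int ffunE.
Qed.

Lemma prod_gauss_bounded : exists C : R, forall L : seq {ffun edge G -> int}, uniq L ->
  \sum_(k <- L) \prod_(a <- enum (edge G)) gauss_int (lam / 2) (k a) <= C.
Proof.
have [B HB] := gauss_int_bounded (divr_gt0 lam_gt0 (ltr0Sn _ 1)).
exists (\prod_(a <- enum (edge G)) B) => L uL.
have [|N0 /(_ N0 (leqnn _)) HN] := finite_exhaustion
    (@pinned_box _ (enum (edge G)) [ffun=> 0]) (finite_seq L).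
  by move=> k _ a; rewrite mem_enum.
apply: le_trans (_ : \sum_(k <- box (enum (edge G)) (symrange N0) [ffun=> 0])
   \prod_(a <- enum (edge G)) gauss_int (lam / 2) (k a) <= _).
  apply: ler_sum_subset => //; first by rewrite uniq_box ?enum_uniq ?uniq_symrange.
  by move=> k; apply: prodr_ge0 => a _; exact: gauss_int_ge0.
rewrite box_prod ?enum_uniq //; last exact: gauss_int_even.
by apply: ler_prod => a _; rewrite HB andbT sumr_ge0 // => i _; exact: gauss_int_ge0.
Qed.

(** Heights with a given outer value inject into integer currents, where the weight is a product
    over edges and the sum factorizes. The bound does not depend on the outer value. *)
Lemma gradient_sum_bounded g : exists C : R, forall (c : int) (L : seq (height G)), uniq L ->
  (forall n, n \in L -> n (outer G) = c) ->
  \sum_(n <- L) gradient_weight predT g n <= C.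
Proof.
have [C HC] := prod_gauss_bounded; exists C => c L uL Lc.
have := HC (map (gradient g) L); rewrite big_map.
under eq_bigr do rewrite -gradient_weight_prod.
apply; rewrite map_inj_in_uniq // => n m nL mL.
by apply: gradient_inj; rewrite !Lc.
Qed.

Lemma sqr_max_min (a b c d : int) :
  (Num.max a b - Num.max c d) ^+ 2 + (Num.min a b - Num.min c d) ^+ 2 <=
  (a - c) ^+ 2 + (b - d) ^+ 2.
Proof. by case: (leP a b) => ab; case: (leP c d) => cd; nia. Qed.

(** The lattice condition for a convex nearest-neighbour interaction, valid edge by edge. *)
Lemma gradient_weight_submodular K n m :
  gradient_weight K (fun=> 0) n * gradient_weight K (fun=> 0) m <=
  gradient_weight K (fun=> 0) (ffun_max n m) * gradient_weight K (fun=> 0) (ffun_min n m).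
Proof.
rewrite /gradient_weight -!expRD ler_expR -!mulrDr !mulNr lerN2 ler_pM2l ?divr_gt0 //.
rewrite -!big_split; apply: ler_sum => a _ /=.
rewrite !subr0 -!rmorphXn -!rmorphD ler_int /coboundary !ffunE.
exact: sqr_max_min.
Qed.

Lemma gradient_weightID K g n :
  gradient_weight predT g n =
  gradient_weight K g n * gradient_weight (predC K) g n.
Proof. rewrite /gradient_weight -expRD -mulrDr; congr (expR (_ * _)).
by rewrite (bigID K). Qed.

Section Pinned.
Variables (S : {set face G}) (K : pred (edge G)).
Hypothesis outS : outer G \in S.
Hypothesis offK : forall a, ~~ K a ->
  (left_face (a, true) \in S) && (right_face (a, true) \in S).

Let s := enum (~: S).

Let sS f : (f \notin s) = (f \in S).
Proof. by rewrite mem_enum inE negbK. Qed.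

Let u := gradient_weight K (fun=> 0).

Definition pinned_sum p : \bar R := (\esum_(n in pinned s p) (u n)%:E)%E.

(** The weight on [K] alone could have infinite sum. By [offK] the missing edges have pinned sides
    and contribute the constant [c]; multiplying by it restores the full, summable weight. *)
Lemma pinned_sum_cvg p : (pinned_sum p < +oo)%E /\
  \sum_(n <- box s (symrange N) p) u n @[N --> \oo] --> fine (pinned_sum p).
Proof.
have [C HC] := gradient_sum_bounded (fun=> 0).
pose c := gradient_weight (predC K) (fun=> 0) p.
have c0 : 0 < c by exact: gradient_weight_gt0.
apply: (@box_sum_cvg _ _ _ _ _ (C / c)) => [|n|N]; first exact: enum_uniq.
  exact: gradient_weight_ge0.
rewrite ler_pdivlMr // mulr_suml.
have ub := uniq_box p (enum_uniq (~: S)) (uniq_symrange N).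
have -> : \sum_(n <- box s (symrange N) p) u n * c =
    \sum_(n <- box s (symrange N) p) gradient_weight predT (fun=> 0) n.
  rewrite big_seq [RHS]big_seq; apply: eq_bigr => n /box_pinned np.
  rewrite (gradient_weightID K); congr (_ * _).
  rewrite /c /gradient_weight; congr (expR (_ * _)); apply: eq_bigr => a Ka.
  have /andP[lS rS] := offK Ka.
  by rewrite /coboundary !np ?sS.
by apply: (HC (p (outer G)) _ ub) => n /box_pinned ->; rewrite ?sS.
Qed.

Lemma pinned_sum_gt0 p : 0 < fine (pinned_sum p).
Proof.
have [fin _] := pinned_sum_cvg p; rewrite fine_gt0 // fin andbT.
apply: lt_le_trans (_ : ((\sum_(n <- [:: p]) u n)%:E <= _)%E).
  by rewrite big_seq1 lte_fin gradient_weight_gt0.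
by apply: sum_uniq_le_esum => // n; rewrite inE => /eqP ->.
Qed.

Lemma pinned_sum_reindex (phi psi : int -> int) p :
  cancel phi psi -> cancel psi phi ->
  (forall n, u [ffun f => phi (n f)] = u n) ->
  pinned_sum [ffun f => phi (p f)] = pinned_sum p.
Proof.
move=> phiK psiK uphi; rewrite /pinned_sum.
rewrite (reindex_esum (pinned s p) _ (fun n : height G => [ffun f => phi (n f)] : height G)).
  by apply: eq_esum => n _; rewrite uphi.
split.
- by move=> n np f fs; rewrite !ffunE np.
- move=> n m _ _ /ffunP nm; apply/ffunP => f; have := nm f; rewrite !ffunE.
  exact: (can_inj phiK).
- move=> n np; exists [ffun f => psi (n f)].
    by move=> f fs; rewrite ffunE np // ffunE phiK.
  by apply/ffunP => f; rewrite !ffunE psiK.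
Qed.

Lemma pinned_sum_shift (t : int) p : pinned_sum [ffun f => p f + t] = pinned_sum p.
Proof.
apply: (@pinned_sum_reindex (+%R^~ t) (+%R^~ (- t))) => [i|i|n].
- by rewrite addrK.
- by rewrite subrK.
- rewrite /u /gradient_weight; congr (expR (_ * _)); apply: eq_bigr => a _.
  by rewrite /coboundary !ffunE opprD addrACA subrr addr0.
Qed.

Lemma pinned_sum_reflect (t : int) p : pinned_sum [ffun f => t - p f] = pinned_sum p.
Proof.
apply: (@pinned_sum_reindex (fun i => t - i) (fun i => t - i)) => [i|i|n].
- by rewrite subKr.
- by rewrite subKr.
- rewrite /u /gradient_weight; congr (expR (_ * _)); apply: eq_bigr => a _.
  rewrite /coboundary !ffunE !subr0 -!rmorphXn /=; congr (_%:~R); ring.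
Qed.

Lemma pinned_sum_four p q :
  fine (pinned_sum p) * fine (pinned_sum q) <=
  fine (pinned_sum (ffun_max p q)) * fine (pinned_sum (ffun_min p q)).
Proof.
have cv r := (pinned_sum_cvg r).2.
apply: (ler_cvg_to (cvgM (cv p) (cv q)) (cvgM (cv (ffun_max p q)) (cv (ffun_min p q)))).
apply: nearW => N; apply: four_functions_box; try by move=> n; exact: gradient_weight_ge0.
exact: gradient_weight_submodular.
Qed.

(* Let [c] stand for truncating the values above [c] to [c], and [c1] for
   truncating them to [c + 1]. Two applications of the four functions theorem give
   Z(c1)^2 <= Z(c)^2, from [c1] and its reflection [2c + 1 - c1], and then
   Z(p) Z(c) <= Z(lowered p) Z(c1), from [p - 1] and [c]. *)
Lemma pinned_sum_lower (c : int) p :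
  (pinned_sum p <= pinned_sum [ffun f => p f - (c + 1 <= p f)%R%:Z]%R)%E.
Proof.
set pm := [ffun f => _].
pose pc : height G := [ffun f => if c + 1 <= p f then c else p f].
pose pc1 : height G := [ffun f => if c + 1 <= p f then c + 1 else p f].
have Z4 := pinned_sum_four.
have fin r : pinned_sum r \is a fin_num.
  rewrite ge0_fin_numE; first exact: (pinned_sum_cvg r).1.
  by apply: esum_ge0 => n _; rewrite lee_fin gradient_weight_ge0.
rewrite -(fineK (fin p)) -(fineK (fin pm)) lee_fin.
have flat : fine (pinned_sum pc1) <= fine (pinned_sum pc).
  have := Z4 pc1 [ffun f => (c + c + 1) - pc1 f].
  rewrite (_ : ffun_max _ _ = [ffun f => (c + c + 1) - pc f]); last first.
    by apply/ffunP => f; rewrite !ffunE; case: ifPn => ?; lia.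
  rewrite (_ : ffun_min _ _ = pc); last first.
    by apply/ffunP => f; rewrite !ffunE; case: ifPn => ?; lia.
  rewrite !pinned_sum_reflect -!expr2 ler_sqr ?nnegrE //; exact/ltW/pinned_sum_gt0.
have := Z4 [ffun f => p f + -1] pc.
rewrite (_ : ffun_max _ _ = pm); last first.
  by apply/ffunP => f; rewrite !ffunE; case: ifPn => ?; lia.
rewrite (_ : ffun_min _ _ = [ffun f => pc1 f + -1]); last first.
  by apply/ffunP => f; rewrite !ffunE; case: ifPn => ?; lia.
rewrite !pinned_sum_shift => H.
rewrite -(ler_pM2r (pinned_sum_gt0 pc)); apply: le_trans H _.
by rewrite ler_pM2l ?pinned_sum_gt0.
Qed.

End Pinned.
End GradientWeights.

Section EsumExtra.
Variable R : realType.

Lemma esum_le_scale (U : choiceType) (D : set U) (a : U -> \bar R) (C : R) :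
  0 <= C -> (forall t, 0 <= a t)%E ->
  (\esum_(t in D) (C%:E * a t) <= C%:E * \esum_(t in D) a t)%E.
Proof.
move=> C0 a0; apply: ge_ereal_sup => _ /= [X [Xf XD] <-].
rewrite -ge0_mule_fsumr; last exact: a0.
rewrite lee_wpmul2l ?lee_fin //; apply: ereal_sup_ubound; by exists X.
Qed.

Lemma le_esum_scale (U : choiceType) (D : set U) (a b : U -> \bar R) (C : R) :
  0 < C -> (forall t, 0 <= a t)%E -> (forall t, 0 <= b t)%E ->
  (\esum_(t in D) a t <= \esum_(t in D) b t)%E ->
  (\esum_(t in D) (C%:E * a t) <= \esum_(t in D) (C%:E * b t))%E.
Proof.
move=> C0 a0 b0 ab; have Cn := lt0r_neq0 C0.
apply: le_trans (esum_le_scale D (ltW C0) a0) _.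
apply: le_trans (lee_wpmul2l _ ab) _; first by rewrite lee_fin ltW.
rewrite (_ : \esum_(t in D) b t = \esum_(t in D) (C^-1%:E * (C%:E * b t)))%E; last first.
  by apply: eq_esum => t _; rewrite muleA -EFinM mulVf // mul1e.
apply: (@le_trans _ _ (C%:E * (C^-1%:E * \esum_(t in D) (C%:E * b t))))%E.
  apply: lee_wpmul2l; first by rewrite lee_fin ltW.
  apply: esum_le_scale; first by rewrite invr_ge0 ltW.
  by move=> t; rewrite mule_ge0 ?lee_fin ?b0 // ltW.
by rewrite muleA -EFinM mulfV // mul1e.
Qed.

Lemma le_esum_subset (U : choiceType) (D D' : set U) (a : U -> \bar R) :
  D `<=` D' -> (\esum_(t in D) a t <= \esum_(t in D') a t)%E.
Proof.
move=> DD'; apply: ge_ereal_sup => _ /= [X [Xf XD] <-].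
by apply: ereal_sup_ubound; exists X => //; split => // t /XD/DD'.
Qed.

Lemma le_esum_classes (U I : choiceType) (D : set U) (key : U -> I)
    (a b : U -> \bar R) :
  (forall t, 0 <= a t)%E -> (forall t, 0 <= b t)%E ->
  (forall t0, D t0 ->
    (\esum_(t in [set t | D t /\ key t = key t0]) a t <=
     \esum_(t in [set t | D t /\ key t = key t0]) b t)%E) ->
  (\esum_(t in D) a t <= \esum_(t in D) b t)%E.
Proof.
move=> a0 b0 ab.
have classE (c : U -> \bar R) : (forall t, 0 <= c t)%E -> (\esum_(t in D) c t =
    \esum_(i in key @` D) \esum_(t in [set t | D t /\ key t = i]) c t)%E.
  move=> c0; rewrite esum_esum //.
  rewrite [RHS](reindex_esum D _ (fun t => (key t, t))) //; split.
  - by move=> t Dt; split => //; exists t.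
  - by move=> t t' _ _ [].
  - by move=> [i t] [/= [t' Dt' _] [Dt <-]]; exists t.
rewrite !classE //; apply: le_esum => _ [t0 Dt0 <-].
exact: ab.
Qed.

End EsumExtra.

(** * The event against the shifted sum, one pinned class at a time *)

Section LevelLineBound.
Variables (R : realType) (G : planeGraph) (lam : R) (x y : vertex G).
Variables (gamma : seq (dart G)) (e : dart G) (qt : height G -> rat).
Hypothesis lam_gt0 : 0 < lam.
Hypothesis neq_xy : x <> y.
Hypothesis gamma_path : simple_path y x gamma.
Hypothesis qt_half : forall n : height G, dirichlet n -> half_integer (qt n).
Hypothesis qt_local : forall n n' : height G, dirichlet n -> dirichlet n' ->
  n (left_face e) = n' (left_face e) ->
  n (right_face e) = n' (right_face e) -> qt n = qt n'.

Let W : height G -> R := gradient_weight lam predT (fun=> 0).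
Let Wg : height G -> R := gradient_weight lam predT (fun a => flow gamma (a, true)).

Let A := [set n : height G | dirichlet n /\ A_event y gamma e (qt n) n].

(** On the event this is the unique witness; elsewhere the empty sequence is a dummy value. *)
Let contour n := xget [::] (A_contour y gamma e (qt n) n).

Let contourP n : A n -> A_contour y gamma e (qt n) n (contour n).
Proof. by case=> _ [s As]; apply: xgetI As. Qed.

(* By [key_pin], the heights of the event sharing a key are exactly those with
   prescribed values on [fixed_faces], free elsewhere. *)
Let key n : {set face G} * height G :=
  (fixed_faces e (contour n),
   [ffun f => if f \in fixed_faces e (contour n) then n f else 0]).

Let pin n0 := pinned (enum (~: fixed_faces e (contour n0))) n0.

Let pinP n0 n : pin n0 n <-> {in fixed_faces e (contour n0), forall f, n f = n0 f}.
Proof.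
split=> [np f fs|np f]; last by rewrite mem_enum inE negbK => /np.
by apply: np; rewrite mem_enum inE negbK.
Qed.

Let scanned_fixed s f : scanned e s f -> f \in fixed_faces e s.
Proof. by move=> fs; rewrite inE; apply/asboolP; left. Qed.

Let outer_fixed s : outer G \in fixed_faces e s.
Proof. by rewrite inE; apply/asboolP; right. Qed.

Let key_pin n0 : A n0 -> [set n | A n /\ key n = key n0] = pin n0.
Proof.
move=> An0; apply/seteqP; split => n /=.
  move=> [An [ES /ffunP En]]; apply/pinP => f fs.
  by have := En f; rewrite !ffunE ES fs.
move=> /pinP np; have [n00 _] := An0.
have nd : dirichlet n by rewrite /dirichlet np.
(* The two faces of [e] are inspected first, hence pinned, so a [qt] that depends on them alone is
   constant on the class. *)
have qE : qt n = qt n0.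
  apply: qt_local => //; apply: np; apply: scanned_fixed.
    exact: scanned_left.
  exact: scanned_right.
have An : A_contour y gamma e (qt n) n (contour n0).
  by rewrite qE; apply: A_contour_local (contourP An0) np.
have An' : A n by split=> //; exists (contour n0).
have cE : contour n = contour n0.
  exact: (A_contour_unique neq_xy gamma_path (contourP An') An).
split=> //; rewrite /key cE; congr (_, _).
by apply/ffunP => f; rewrite !ffunE; case: ifP => // /np.
Qed.

Lemma pinned_eq (s : seq (face G)) (p p' : height G) :
  (forall f, f \notin s -> p f = p' f) -> pinned s p = pinned s p'.
Proof. by move=> pp'; apply/seteqP; split => n np f fs; rewrite np ?pp'. Qed.

Let class_le n0 : A n0 ->
  (\esum_(n in pin n0) (W n)%:E <= \esum_(n in pin n0) (Wg n)%:E)%E.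
Proof.
move=> An0; have [n00 _] := An0; have Ac := contourP An0.
have [k [h0 [h [h_out hl sides]]]] := A_contour_potential (qt_half n00) n00 Ac.
set s := contour n0 in Ac sides *; set S := fixed_faces e s in sides *.
pose K : pred (edge G) := fun a => a \notin [seq d.1 | d <- e :: s].
have [_ _ /and4P[_ _ _ uedge] _] := Ac.
have onK a : ~~ K a -> exists b, (a, b) \in e :: s.
  by rewrite negbK => /mapP[[a' b] abs ->]; exists b.
have offK a : ~~ K a -> (left_face (a, true) \in S) && (right_face (a, true) \in S).
  move=> /onK[b /scanned_mem[]]; case: b => [|].
    by move=> /scanned_fixed-> /scanned_fixed->.
  rewrite -[(a, false)]/(rev (a, true)) /right_face revK => l r.
  by rewrite (scanned_fixed l) (scanned_fixed r).
(* The loop uses no edge twice, so [gamma] avoids the edges of the contour. *)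
have flow_gamma a : ~~ K a -> flow gamma (a, true) = 0.
  move=> Ka; apply: flow_off; apply/negP => ag.
    move: uedge; rewrite map_cat cat_uniq => /and3P[_ /hasPn/(_ a)].
    by move: Ka; rewrite negbK => as_ /(_ as_); rewrite (map_f fst ag).
  move: uedge; rewrite map_cat cat_uniq => /and3P[_ /hasPn/(_ a)].
  by move: Ka; rewrite negbK => as_ /(_ as_); rewrite (map_f fst ag).
have flow_s a : K a -> flow (e :: s) (a, true) = 0.
  by move=> Ka; apply: flow_off; apply/negP => /(map_f fst); apply/negP.
pose C := gradient_weight lam (predC K) (fun=> 0) n0.
have C0 : 0 < C by exact: gradient_weight_gt0.
have WE n : pin n0 n -> W n = C * gradient_weight lam K (fun=> 0) n.
  move=> /pinP np; rewrite /W (gradient_weightID _ K) mulrC; congr (_ * _).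
  rewrite /C /gradient_weight; congr (expR (_ * _)); apply: eq_bigr => a Ka.
  have /andP[lS rS] := offK a Ka.
  by rewrite /coboundary !np.
have WgE n : pin n0 n -> Wg n = C * gradient_weight lam K (fun=> 0) [ffun f => n f - h f].
  move=> /pinP np; rewrite /Wg (gradient_weightID _ K) mulrC; congr (_ * _).
    rewrite /C /gradient_weight; congr (expR (_ * _)); apply: eq_bigr => a Ka.
    have /andP[lS rS] := offK a Ka.
    by rewrite flow_gamma // /coboundary !np.
  (* Off the contour the flow of the loop is that of [gamma], so [dn - gamma = dn - dh] there. *)
  rewrite /gradient_weight; congr (expR (_ * _)); apply: eq_bigr => a Ka.
  have := hl (a, true); rewrite flow_s // addr0 => <-.
  by rewrite subr0 /coboundary !ffunE; congr (_%:~R ^+ 2); ring.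
rewrite (eq_esum (b := fun n : height G => (C%:E * (gradient_weight lam K (fun=> 0) n)%:E)%E)); last first.
  by move=> n np; rewrite WE // EFinM.
rewrite [leRHS](eq_esum (b := fun n : height G =>
    (C%:E * (gradient_weight lam K (fun=> 0) [ffun f => n f - h f])%:E)%E)); last first.
  by move=> n np; rewrite WgE // EFinM.
apply: le_esum_scale => //; try by move=> n; rewrite lee_fin gradient_weight_ge0.
have := pinned_sum_lower lam_gt0 (outer_fixed s) offK k n0.
rewrite /pinned_sum; set pm := [ffun f => _] => /le_trans; apply.
(* On pinned faces [n0 - h] is the lowered [n0] minus [h0]; the global constant is absorbed by shift
   invariance. *)
rewrite -/(pinned_sum lam S K pm) -(pinned_sum_shift lam S K (- h0) pm) /pinned_sum.
rewrite (@pinned_eq _ _ [ffun f => n0 f - h f]); last first.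
  move=> f; rewrite mem_enum inE negbK => fS; rewrite !ffunE.
  by case: (sides f fS) => -[]; case: (boolP (k + 1 <= n0 f)); lia.
rewrite [leLHS](reindex_esum (pin n0) _ (fun n : height G => [ffun f => n f - h f] : height G)) //.
split.
- by move=> n np f fs; rewrite !ffunE np.
- move=> n m _ _ /ffunP nm; apply/ffunP => f; have := nm f; rewrite !ffunE; lia.
- move=> n np; exists [ffun f => n f + h f].
    by move=> f fs; rewrite ffunE np // ffunE subrK.
  by apply/ffunP => f; rewrite !ffunE addrK.
Qed.

(** The comparison already holds with both sums over the event; positivity extends the right one to
    all Dirichlet heights. *)
Lemma level_line_bound :
  (\esum_(n in A) (W n)%:E <= \esum_(n in @dirichlet G) (Wg n)%:E)%E.
Proof.
apply: le_trans (le_esum_subset _ (_ : A `<=` @dirichlet G)); last by move=> n [].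
apply: (le_esum_classes (key := key)) => [n|n|n0 An0].
- by rewrite lee_fin gradient_weight_ge0.
- by rewrite lee_fin gradient_weight_ge0.
- by rewrite key_pin //; exact: class_le.
Qed.

End LevelLineBound.

(** * Integration over angles *)

Section AngleIntegrals.
Variable R : realType.
Implicit Types (f g : R -> R) (t : R).

Lemma sinD2piz t (m : int) : sin (t + 2 * pi * m%:~R) = sin t.
Proof.
have posE (n : nat) (u : R) : sin (u + 2 * pi * n%:R) = sin u.
  by rewrite -(periodicn (@sinD2pi R) n u) -(mulr_natr (pi *+ 2) n) -(mulr_natr pi 2); congr sin; ring.
case: m => n; first exact: posE.
by rewrite -[LHS](posE n.+1); congr sin; rewrite NegzE mulrNz -pmulrn; ring.
Qed.

Lemma cosD2piz t (m : int) : cos (t + 2 * pi * m%:~R) = cos t.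
Proof.
have posE (n : nat) (u : R) : cos (u + 2 * pi * n%:R) = cos u.
  by rewrite -(periodicn (@cosD2pi R) n u) -(mulr_natr (pi *+ 2) n) -(mulr_natr pi 2); congr cos; ring.
case: m => n; first exact: posE.
by rewrite -[LHS](posE n.+1); congr cos; rewrite NegzE mulrNz -pmulrn; ring.
Qed.

Lemma is_derive_continuous f (df : R -> R) :
  (forall t, is_derive t 1 f (df t)) -> continuous f.
Proof.
move=> fd t; apply: differentiable_continuous; apply/derivable1_diffP.
by have [] := fd t.
Qed.

Lemma is_derive_affine (k A t : R) : is_derive t 1 (fun t => k * t + A) k.
Proof.
have -> : (fun t => k * t + A) = (k *: id) + cst A by apply/funext => u.
by apply: is_derive_eq; rewrite addr0 /GRing.scale /= mulr1.
Qed.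

Lemma is_derive_sin_affine (k A t : R) :
  is_derive t 1 (fun t => sin (k * t + A)) (k * cos (k * t + A)).
Proof.
have H := is_derive_affine k A t.
by apply: is_derive_eq (is_derive1_comp (is_derive_sin _) H) _; rewrite mulrC.
Qed.

Lemma is_derive_cos_affine (k A t : R) :
  is_derive t 1 (fun t => cos (k * t + A)) (- (k * sin (k * t + A))).
Proof.
have H := is_derive_affine k A t.
by apply: is_derive_eq (is_derive1_comp (is_derive_cos _) H) _; rewrite mulrC mulrN.
Qed.

Lemma continuous_cos_affine (k A : R) : continuous (fun t : R => cos (k * t + A)).
Proof. exact: is_derive_continuous (is_derive_cos_affine k A). Qed.

Lemma continuous_sin_affine (k A : R) : continuous (fun t : R => sin (k * t + A)).
Proof. exact: is_derive_continuous (is_derive_sin_affine k A). Qed.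

Definition aint f : R := \int[lebesgue_measure]_(t in `[- pi, pi[) f t.

Lemma itv_pi_measurable : measurable (`[- pi, pi[%classic : set R).
Proof. exact: measurable_itv. Qed.

Lemma continuous_integrable_pi f : continuous f ->
  lebesgue_measure.-integrable `[- pi, pi[ (EFin \o f).
Proof.
move=> fc; have I : lebesgue_measure.-integrable `[- pi, pi] (EFin \o f).
  apply: continuous_compact_integrable; first exact: segment_compact.
  exact: continuous_subspaceT.
apply: integrableS I => //.
by move=> t /=; rewrite !in_itv /= => /andP[-> /ltW].
Qed.

Lemma aintD f g : continuous f -> continuous g ->
  aint (fun t => f t + g t) = aint f + aint g.
Proof. by move=> fc gc; apply: RintegralD => //; exact: continuous_integrable_pi. Qed.

Lemma aintB f g : continuous f -> continuous g ->
  aint (fun t => f t - g t) = aint f - aint g.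
Proof. by move=> fc gc; apply: RintegralB => //; exact: continuous_integrable_pi. Qed.

Lemma aintZ c f : continuous f -> aint (fun t => c * f t) = c * aint f.
Proof. by move=> fc; apply: RintegralZl => //; exact: continuous_integrable_pi. Qed.

Lemma aint_ext f g : (forall t, - pi <= t < pi -> f t = g t) -> aint f = aint g.
Proof. by move=> fg; apply: eq_Rintegral => t; rewrite inE /= in_itv /= => /fg. Qed.

Lemma aint_cst (c : R) : aint (fun=> c) = 2 * pi * c.
Proof.
have pp : - pi < pi :> R by have := pi_gt0 R; lra.
rewrite /aint Rintegral_cst // mulrC.
have E : lebesgue_measure (`[- pi, pi[%classic : set R) = (2 * pi)%:E.
  by rewrite lebesgue_measure_itv /= lte_fin pp -EFinB; congr (_%:E); ring.
rewrite -[2 * pi]/(fine (2 * pi)%:E); congr (fine _ * _); exact: E.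
Qed.

Lemma continuous_cst_fun (c : R) : continuous (fun _ : R => c).
Proof. by move=> t; exact: cvg_cst. Qed.

Lemma aint_le f g : continuous f -> continuous g ->
  (forall t, - pi <= t < pi -> f t <= g t) -> aint f <= aint g.
Proof.
move=> fc gc fg; apply: le_Rintegral => //; try exact: continuous_integrable_pi.
Qed.

Lemma aint_norm_le f (C : R) : continuous f ->
  (forall t, - pi <= t < pi -> `|f t| <= C) -> `|aint f| <= 2 * pi * C.
Proof.
move=> fc fC; rewrite ler_norml -aint_cst; apply/andP; split.
  have -> : - aint (fun=> C) = aint (fun=> - C) by rewrite !aint_cst mulrN.
  apply: aint_le => //; first exact: continuous_cst_fun.
  by move=> t /fC; rewrite ler_norml => /andP[].
apply: aint_le => //; first exact: continuous_cst_fun.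
by move=> t /fC; rewrite ler_norml => /andP[].
Qed.

Lemma continuous_sum (I : Type) (r : seq I) (F : I -> R -> R) :
  (forall i, continuous (F i)) -> continuous (fun t => \sum_(i <- r) F i t).
Proof.
move=> Fc; elim: r => [|i r IH] t.
  by under eq_fun do rewrite big_nil; exact: cvg_cst.
under eq_fun do rewrite big_cons.
exact: (continuousD (Fc i t) (IH t)).
Qed.

Lemma aint_sum (I : Type) (r : seq I) (F : I -> R -> R) :
  (forall i, continuous (F i)) ->
  aint (fun t => \sum_(i <- r) F i t) = \sum_(i <- r) aint (F i).
Proof.
move=> Fc; elim: r => [|i r IH].
  rewrite big_nil -[RHS](mulr0 (2 * pi)) -aint_cst.
  by apply: aint_ext => t _; rewrite big_nil.
rewrite big_cons -IH -aintD //; last exact: continuous_sum.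
by apply: aint_ext => t _; rewrite big_cons.
Qed.

Lemma aint_FTC f F : continuous f -> (forall t, is_derive t 1 F (f t)) ->
  aint f = F pi - F (- pi).
Proof.
move=> fc Fd; have Fc := is_derive_continuous Fd.
have pp : - pi < pi :> R by have := pi_gt0 R; lra.
rewrite /aint Rintegral_itv_bndo_bndc; last exact: continuous_integrable_pi.
rewrite /Rintegral (@continuous_FTC2 _ f F) //.
- exact: continuous_subspaceT.
- split.
  + by move=> t _; have [] := Fd t.
  + exact: cvg_at_right_filter (Fc _).
  + exact: cvg_at_left_filter (Fc _).
- by move=> t _; rewrite derive1E; have [_ ->] := Fd t.
Qed.

Lemma aint_cos (k : int) (A : R) :
  aint (fun t => cos (k%:~R * t + A)) = 2 * pi * ((k == 0)%:R * cos A).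
Proof.
have [->|k0] := eqVneq k 0.
  by rewrite mul1r -aint_cst; apply: aint_ext => t _; rewrite mul0r add0r.
rewrite mul0r mulr0.
have kn0 : k%:~R != 0 :> R by rewrite intr_eq0.
have Fd (t : R) : is_derive t 1 (fun t => k%:~R^-1 * sin (k%:~R * t + A))
    (cos (k%:~R * t + A)).
  have H := is_derive_sin_affine k%:~R A t.
  have := is_deriveZ (k%:~R^-1) H.
  by rewrite /GRing.scale /= mulrA mulVf // mul1r.
rewrite (aint_FTC (@continuous_cos_affine _ _) Fd).
rewrite -mulrBr -(sinD2piz (k%:~R * - pi + A) k).
by rewrite (_ : _ + A + _ = k%:~R * pi + A) ?subrr ?mulr0 //; ring.
Qed.

Lemma continuous_locally_unif f :
  (forall A eps : R, 0 < eps -> exists g, continuous g /\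
     forall t, `|t| <= A -> `|f t - g t| <= eps) -> continuous f.
Proof.
move=> fg t; apply/cvgrPdist_le => eps eps0.
have e3 : 0 < eps / 3 by rewrite divr_gt0.
have [g [gc gE]] := fg (`|t| + 1) (eps / 3) e3.
have /cvgrPdist_le/(_ (eps / 3) e3) gt := gc t.
have /cvgrPdist_le/(_ 1 ltr01) id1 : id u @[u --> t] --> t by exact: cvg_id.
near=> u.
have tA : `|f t - g t| <= eps / 3 by apply: gE; rewrite lerDl.
have uA : `|f u - g u| <= eps / 3.
  apply: gE; have -> : u = t + (u - t) by ring.
  apply: le_trans (ler_normD _ _) _; rewrite lerD2l distrC.
  by near: u; exact: id1.
have -> : f t - f u = (f t - g t) + (g t - g u) - (f u - g u) by ring.
apply: le_trans (ler_normB _ _) _; apply: (@le_trans _ _ (eps / 3 + eps / 3 + eps / 3)).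
  rewrite lerD //; apply: le_trans (ler_normD _ _) _.
  by rewrite lerD //; near: u.
by lra.
Unshelve. all: by end_near.
Qed.

Lemma continuous_unif f : (forall eps, 0 < eps ->
  exists g, continuous g /\ forall t, `|f t - g t| <= eps) -> continuous f.
Proof.
move=> fg; apply: continuous_locally_unif => A eps /fg[g [gc gE]].
by exists g; split.
Qed.

(** Adding [M] makes the integrand nonnegative, so its integral may be restricted to [[a, b]]; the
    added [2 * pi * M] is then subtracted. *)
Lemma aint_ge_interval f (a b C M : R) : continuous f -> - pi <= a -> a <= b -> b < pi ->
  0 <= M -> (forall t, - pi <= t < pi -> - M <= f t) ->
  (forall t, a <= t <= b -> C <= f t) ->
  (C + M) * (b - a) - 2 * pi * M <= aint f.
Proof.
move=> fc pa ab bp M0 fM fC.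
have gc : continuous (fun t => f t + M).
  by move=> t; exact: (continuousD (fc t) (@continuous_cst_fun M t)).
have -> : aint f = aint (fun t => f t + M) - 2 * pi * M.
  by rewrite aintD // ?aint_cst ?addrK //; exact: continuous_cst_fun.
rewrite lerD2r.
have sub : `[a, b] `<=` `[- pi, pi[.
  move=> t /=; rewrite !in_itv /= => /andP[at_ tb].
  by rewrite (le_trans pa at_) (le_lt_trans tb bp).
have I := continuous_integrable_pi gc.
have Iab : lebesgue_measure.-integrable `[a, b] (EFin \o (fun t => f t + M)).
  by apply: integrableS I => //; exact: sub.
have Icst : lebesgue_measure.-integrable `[a, b] (EFin \o (fun=> C + M)).
  apply: continuous_compact_integrable; first exact: segment_compact.
  apply: continuous_subspaceT; exact: continuous_cst_fun.
apply: (@le_trans _ _ (\int[lebesgue_measure]_(t in `[a, b]) (f t + M))).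
  apply: (@le_trans _ _ (\int[lebesgue_measure]_(t in `[a, b]) (C + M))).
    rewrite Rintegral_cst //.
    have E : lebesgue_measure (`[a, b]%classic : set R) = (b - a)%:E.
      rewrite lebesgue_measure_itv /= lte_fin.
      move: ab; rewrite le_eqVlt => /predU1P[->|->]; last by rewrite EFinB.
      by rewrite ltxx subrr.
    by rewrite -[b - a]/(fine (b - a)%:E) -E.
  apply: le_Rintegral => // t /=; rewrite in_itv /= => tab.
  by rewrite lerD2r fC.
rewrite /aint /Rintegral; apply: fine_le.
- exact: integrable_fin_num.
- exact: integrable_fin_num.
apply: ge0_subset_integral => //; first by case/integrableP: I.
by move=> t /=; rewrite in_itv /= => /fM; rewrite lee_fin; lra.
Qed.

End AngleIntegrals.

Section AngleIntegral.
Variables (R : realType) (G : ribbonGraph).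
Local Notation V := (vertex G).
Implicit Types (P : seq (R * {ffun V -> int})) (theta : V -> R).
Implicit Types (F : (V -> R) -> R) (s : seq V).

Definition trigpoly P theta : R :=
  \sum_(ck <- P) ck.1 * cos (\sum_v (ck.2 v)%:~R * theta v).

Definition set_angle theta (v : V) (t : R) : V -> R :=
  fun u => if u == v then t else theta u.

Lemma phase_set_angle (k : {ffun V -> int}) theta v t :
  \sum_u (k u)%:~R * set_angle theta v t u =
  (k v)%:~R * t + \sum_(u | u != v) (k u)%:~R * theta u.
Proof.
rewrite (bigD1 v) //= /set_angle eqxx; congr (_ + _).
by apply: eq_bigr => u /negPf ->.
Qed.

(** Integrating one angle kills the frequencies nonzero there and multiplies the others by [2 * pi];
    the result is again a trigonometric polynomial, which keeps the induction going. *)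
Lemma angle_integral_over_trigpoly P s theta : uniq s ->
  angle_integral_over s (trigpoly P) theta =
  (2 * pi) ^+ size s * \sum_(ck <- P) ck.1 * (all (fun v => ck.2 v == 0) s)%:R
     * cos (\sum_v (ck.2 v)%:~R * theta v).
Proof.
elim: s theta => [|v s IH] theta /=.
  move=> _; rewrite expr0 mul1r; apply: eq_bigr => ck _; by rewrite mulr1.
move=> /andP[vs us].
rewrite -[LHS]/(aint (fun t => angle_integral_over s (trigpoly P) (set_angle theta v t))).
under [X in aint X]eq_fun do rewrite IH //.
rewrite aintZ; last first.
  apply: continuous_sum => ck t; under eq_fun do rewrite phase_set_angle.
  exact: (continuousM (@continuous_cst_fun _ _ _) (@continuous_cos_affine _ _ _ _)).
rewrite aint_sum; last first.
  move=> ck t; under eq_fun do rewrite phase_set_angle.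
  exact: (continuousM (@continuous_cst_fun _ _ _) (@continuous_cos_affine _ _ _ _)).
rewrite exprS -mulrA mulrCA; congr (_ * _); rewrite mulr_sumr; apply: eq_bigr => ck _.
under [X in aint X]eq_fun do rewrite phase_set_angle.
rewrite aintZ; last exact: continuous_cos_affine.
rewrite aint_cos [in RHS](bigD1 v) //=.
have [->|kv] := eqVneq (ck.2 v) 0; last by rewrite !(mul0r, mulr0).
by rewrite mulr0z mul0r add0r /=; ring.
Qed.

Lemma continuous_trigpoly_integral P s theta v : uniq s ->
  continuous (fun t => angle_integral_over s (trigpoly P) (set_angle theta v t)).
Proof.
move=> us; under eq_fun do rewrite angle_integral_over_trigpoly //.
have Cs : continuous (fun t => \sum_(ck <- P) ck.1 * (all (fun u => ck.2 u == 0) s)%:R *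
    cos (\sum_u (ck.2 u)%:~R * set_angle theta v t u)).
  apply: continuous_sum => ck t; under eq_fun do rewrite phase_set_angle.
  exact: (continuousM (@continuous_cst_fun _ _ _) (@continuous_cos_affine _ _ _ _)).
by move=> t; exact: (continuousM (@continuous_cst_fun _ _ _) (Cs t)).
Qed.

Definition trig_approximable F : Prop := forall eps : R, 0 < eps ->
  exists P, forall theta, `|F theta - trigpoly P theta| <= eps.

(** Subtracting iterated integrals requires each inner integral to be integrable in the next angle.
    Uniform approximation by trigonometric polynomials gives continuity at every stage, and the
    error only gains a factor [2 * pi] per angle. *)
Lemma angle_integral_over_approx F s : trig_approximable F -> uniq s ->
  (forall P eps theta, (forall theta', `|F theta' - trigpoly P theta'| <= eps) ->
     `|angle_integral_over s F theta - angle_integral_over s (trigpoly P) theta|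
       <= (2 * pi) ^+ size s * eps) /\
  (forall theta v, continuous (fun t => angle_integral_over s F (set_angle theta v t))).
Proof.
move=> Fapp us.
suff H : forall P (eps : R) theta, (forall theta', `|F theta' - trigpoly P theta'| <= eps) ->
     `|angle_integral_over s F theta - angle_integral_over s (trigpoly P) theta|
       <= (2 * pi) ^+ size s * eps.
  split=> // theta v; apply: continuous_unif => eps eps0.
  have pos : 0 < (2 * pi) ^+ size s :> R by rewrite exprn_gt0 // mulr_gt0 ?pi_gt0.
  have [P HP] := Fapp (eps / (2 * pi) ^+ size s) (divr_gt0 eps0 pos).
  exists (fun t => angle_integral_over s (trigpoly P) (set_angle theta v t)).
  split; first exact: continuous_trigpoly_integral.
  move=> t; apply: le_trans (H P _ _ HP) _.
  by rewrite mulrC divfK // gt_eqF.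
elim: s us => [|v s IH] /= us P eps theta HP; first by rewrite expr0 mul1r.
have /andP[vs us'] := us.
have gc : continuous (fun t => angle_integral_over s F (set_angle theta v t)).
  apply: continuous_unif => e e0.
  have pos : 0 < (2 * pi) ^+ size s :> R by rewrite exprn_gt0 // mulr_gt0 ?pi_gt0.
  have [Q HQ] := Fapp (e / (2 * pi) ^+ size s) (divr_gt0 e0 pos).
  exists (fun t => angle_integral_over s (trigpoly Q) (set_angle theta v t)).
  split; first exact: continuous_trigpoly_integral.
  move=> t; apply: le_trans (IH us' Q _ _ HQ) _.
  by rewrite mulrC divfK // gt_eqF.
have hc := @continuous_trigpoly_integral P s theta v us'.
rewrite -[X in `|X - _|]/(aint (fun t => angle_integral_over s F (set_angle theta v t))).
rewrite -[X in `|_ - X|]/(aint (fun t => angle_integral_over s (trigpoly P) (set_angle theta v t))).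
rewrite -aintB // exprS -mulrA; apply: aint_norm_le => [t|t _].
  exact: (continuousB (gc t) (hc t)).
exact: IH.
Qed.

(** Over all angles only the zero frequency of [P N] survives, with an error of at most [eps N]
    times the volume. *)
Lemma angle_integral_lim F (P : nat -> seq (R * {ffun V -> int})) (eps : nat -> R) :
  (forall N theta, `|F theta - trigpoly (P N) theta| <= eps N) ->
  eps N @[N --> \oo] --> 0 ->
  (2 * pi) ^+ #|V| * \sum_(ck <- P N) ck.1 * (ck.2 == [ffun=> 0])%:R @[N --> \oo]
    --> angle_integral F.
Proof.
move=> HP eps0.
have Fapp : trig_approximable F.
  move=> e e0; have /cvgrPdist_le/(_ e e0) [N _ HN] := eps0.
  exists (P N) => theta; apply: le_trans (HP N theta) _.
  by have := HN N (leqnn N); rewrite /= sub0r normrN; apply/le_trans/ler_norm.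
have [H _] := angle_integral_over_approx Fapp (enum_uniq V).
have constE N : (2 * pi) ^+ #|V| * \sum_(ck <- P N) ck.1 * (ck.2 == [ffun=> 0])%:R =
    angle_integral (trigpoly (P N)).
  rewrite /angle_integral angle_integral_over_trigpoly ?enum_uniq // -cardE; congr (_ * _).
  apply: eq_bigr => ck _; rewrite [X in cos X]big1 ?cos0 ?mulr1; last first.
    by move=> v _; rewrite mulr0.
  congr (_ * _%:R); congr (nat_of_bool _); apply/eqP/allP => [-> v _|E].
    by rewrite ffunE.
  by apply/ffunP => v; rewrite ffunE; apply/eqP/E; rewrite mem_enum.
under eq_fun do rewrite constE.
apply/cvgrPdist_le => e e0.
have pos : 0 < (2 * pi) ^+ #|V| :> R by rewrite exprn_gt0 // mulr_gt0 ?pi_gt0.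
have /cvgrPdist_le/(_ _ (divr_gt0 e0 pos)) := eps0.
apply: filterS => N /=; rewrite sub0r normrN => epsN.
apply: le_trans (H (P N) (eps N) (fun=> 0) (HP N)) _.
rewrite -cardE mulrC -ler_pdivlMr //.
exact: le_trans (ler_norm _) epsN.
Qed.

End AngleIntegral.

(** * Poisson summation for the Villain weight *)

Section FourierUniqueness.
Variable R : realType.

(** Product-to-sum: a factor [b + cos (t - t0)] turns frequency [k] into [k], [k + 1] and [k - 1],
    so vanishing moments stay zero. *)
Lemma trig_moment_pow (D : R -> R) (b t0 : R) : continuous D ->
  (forall (k : int) A, aint (fun t => D t * cos (k%:~R * t + A)) = 0) ->
  forall (N : nat) (k : int) A,
    aint (fun t => D t * (b + cos (t - t0)) ^+ N * cos (k%:~R * t + A)) = 0.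
Proof.
move=> Dc D0; elim=> [|N IH] k A.
  by under [X in aint X]eq_fun do rewrite expr0 mulr1; exact: D0.
have powc M : continuous (fun t => D t * (b + cos (t - t0)) ^+ M).
  elim: M => [|M IHM].
    by under eq_fun do rewrite expr0 mulr1; exact: Dc.
  have -> : (fun t => D t * (b + cos (t - t0)) ^+ M.+1) =
      (fun t => (D t * (b + cos (t - t0)) ^+ M) * (b + cos (1 * t + - t0))).
    by apply/funext => t; rewrite exprSr mulrA mul1r.
  move=> t; apply: (continuousM (IHM t)).
  exact: (continuousD (@continuous_cst_fun _ b t) (@continuous_cos_affine _ 1 (- t0) t)).
have termc (j : int) B : continuous
    (fun t => D t * (b + cos (t - t0)) ^+ N * cos (j%:~R * t + B)).
  by move=> t; exact: (continuousM (powc N t) (@continuous_cos_affine _ _ _ t)).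
have scalec (c : R) (g : R -> R) : continuous g -> continuous (fun t => c * g t).
  by move=> gc t; exact: (continuousM (@continuous_cst_fun _ c t) (gc t)).
have -> : (fun t => D t * (b + cos (t - t0)) ^+ N.+1 * cos (k%:~R * t + A)) =
  (fun t => b * (D t * (b + cos (t - t0)) ^+ N * cos (k%:~R * t + A)) +
    (2^-1 * (D t * (b + cos (t - t0)) ^+ N * cos ((k + 1)%:~R * t + (A - t0))) +
     2^-1 * (D t * (b + cos (t - t0)) ^+ N * cos ((k - 1)%:~R * t + (A + t0))))).
  apply/funext => t; rewrite exprSr.
  have -> : (k + 1)%:~R * t + (A - t0) = (k%:~R * t + A) + (t - t0).
    by rewrite rmorphD /=; ring.
  have -> : (k - 1)%:~R * t + (A + t0) = (k%:~R * t + A) - (t - t0).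
    by rewrite rmorphB /=; ring.
  by move: (k%:~R * t + A) (t - t0) => u w; rewrite cosD cosB; field.
rewrite aintD; [|exact/scalec/termc|].
  rewrite aintD; [|exact/scalec/termc|exact/scalec/termc].
  by rewrite !aintZ ?IH; [rewrite !mulr0 !addr0|exact: termc..].
by move=> t; exact: (continuousD (scalec _ _ (termc _ _) t) (scalec _ _ (termc _ _) t)).
Qed.

Lemma bernoulli_unbounded (eta C : R) : 0 < eta -> exists N, C < (1 + eta) ^+ N.
Proof.
move=> eta0; have bern N : 1 + N%:R * eta <= (1 + eta) ^+ N.
  elim: N => [|N IH]; first by rewrite mul0r addr0 expr0.
  rewrite exprSr; apply: (@le_trans _ _ ((1 + N%:R * eta) * (1 + eta))).
    have : 0 <= N%:R * eta * eta by rewrite !mulr_ge0 // ltW.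
    by rewrite -natr1; nra.
  by rewrite ler_pM2r //; lra.
have [N HN] : exists N : nat, C / eta < N%:R.
  exists (Num.bound `|C / eta|); apply: le_lt_trans (ler_norm _) _.
  exact: archi_boundP (normr_ge0 _).
exists N; apply: lt_le_trans (bern N); rewrite ltr_pdivrMr // in HN.
by lra.
Qed.

(* If [D t0 > 0], test [D] against the powers of [1 - cos del + cos (t - t0)],
   which grow geometrically near [t0] and stay bounded by 1 beyond distance [del]. *)
Lemma fourier_nonpos (D : R -> R) t0 : continuous D ->
  (forall (k : int) A, aint (fun t => D t * cos (k%:~R * t + A)) = 0) ->
  - pi < t0 < pi -> D t0 <= 0.
Proof.
move=> Dc D0 /andP[t0l t0r]; rewrite leNgt; apply/negP => Dt0.
have pi0 := pi_gt0 R.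
have [M HM] : exists M, forall t, - pi <= t < pi -> `|D t| <= M.
  have pp : - pi <= pi :> R by lra.
  have nc : {within `[- pi, pi], continuous (fun t => `|D t|)}.
    by apply: continuous_subspaceT => t; apply: cvg_norm; exact: Dc.
  have [m _ mM] := EVT_max pp nc.
  exists `|D m| => t /andP[tl tr]; apply: mM.
  by rewrite in_itv /= tl ltW.
have M0 : 0 <= M by apply: le_trans (HM t0 _); rewrite ?normr_ge0 // ltW.
have D2 : 0 < D t0 / 2 by rewrite divr_gt0.
have /cvgrPdist_le/(_ _ D2) [r /= r0 Hr] := Dc t0.
(* [r / 2] keeps [D] above [D t0 / 2], [pi / 2] keeps [del] where the cosine decreases, and the last
   two terms leave a margin of [2 * del] between [t0] and each end of the period. *)
pose del := Num.min (Num.min (r / 2) (pi / 2)) (Num.min ((t0 + pi) / 2) ((pi - t0) / 2)).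
have del0 : 0 < del by rewrite !lt_min; apply/andP; split; apply/andP; split; lra.
have delr : del < r by apply: (@le_lt_trans _ _ (r / 2)); [rewrite !ge_min lexx|lra].
have delp : del <= pi / 2 by rewrite !ge_min lexx ?orbT.
have dell : del <= (t0 + pi) / 2 by rewrite !ge_min lexx ?orbT.
have delrr : del <= (pi - t0) / 2 by rewrite !ge_min lexx ?orbT.
have Dbig t : `|t - t0| <= del -> D t0 / 2 <= D t.
  move=> tt0; have := Hr t; rewrite /ball_ /= distrC => /(_ (le_lt_trans tt0 delr)).
  by rewrite ler_norml; lra.
pose q t := (1 - cos del) + cos (t - t0).
have cosmono (u v : R) : 0 <= u -> u <= v -> v <= pi -> cos v <= cos u.
  move=> u0 uv vp; rewrite le_eqVlt; have [->|] := eqVneq u v; first by rewrite eqxx.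
  move=> nuv; rewrite ltr_cos ?in_itv /= ?lt_neqAle ?nuv ?uv ?orbT //.
  - by rewrite u0 (le_trans uv vp).
  - by rewrite (le_trans u0 uv).
have coseven (u : R) : cos u = cos `|u| by rewrite cos_norm.
pose eta := cos (del / 2) - cos del.
have eta0 : 0 < eta.
  rewrite subr_gt0 ltr_cos ?in_itv /=; first lra.
    by apply/andP; split; lra.
  by apply/andP; split; lra.
have hc N : continuous (fun t => D t * q t ^+ N).
  have qc : continuous q.
    have -> : q = (fun t => (1 - cos del) + cos (1 * t + - t0)).
      by apply/funext => t; rewrite mul1r.
    move=> t; exact: (continuousD (@continuous_cst_fun _ _ t) (@continuous_cos_affine _ 1 (- t0) t)).
  have powc : continuous (fun t => q t ^+ N).
    elim: N => [|N IH].
      have -> : (fun t => q t ^+ 0) = (fun=> 1) by apply/funext => t; rewrite expr0.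
      exact: continuous_cst_fun.
    have -> : (fun t => q t ^+ N.+1) = (fun t => q t * q t ^+ N).
      by apply/funext => t; rewrite exprS.
    by move=> t; exact: (continuousM (qc t) (IH t)).
  by move=> t; exact: (continuousM (Dc t) (powc t)).
(* On the inner interval, of length [del], the integral exceeds [2 * pi * M], more than the rest of
   the period can compensate. *)
have [N HN] := bernoulli_unbounded (2 * pi * M / (D t0 / 2 * del)) eta0.
have int0 : aint (fun t => D t * q t ^+ N) = 0.
  rewrite -[RHS](trig_moment_pow (1 - cos del) t0 Dc D0 N 0 0); congr aint.
  by apply/funext => t; rewrite mul0r addr0 cos0 mulr1.
have low : (D t0 / 2 * (1 + eta) ^+ N + M) * ((t0 + del / 2) - (t0 - del / 2))
    - 2 * pi * M <= 0.
  rewrite -[X in _ <= X]int0; apply: aint_ge_interval => //; try lra.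
    move=> t tpi; have [tn|tn] := leP `|t - t0| del.
      have D0t := le_trans (ltW D2) (Dbig t tn).
      have q0 : 0 <= q t.
        have : cos del <= cos (t - t0) by rewrite [leRHS]coseven; apply: cosmono => //; lra.
        by rewrite /q; have := cos_le1 del; lra.
      by apply: (@le_trans _ _ 0); [lra|rewrite mulr_ge0 // exprn_ge0].
    have qn : `|q t| <= 1.
      have c1 : cos (t - t0) <= cos del.
        case: (leP `|t - t0| pi) => [tp|tp].
          by rewrite coseven; apply: cosmono => //; exact: ltW.
        (* Beyond distance [pi] the distance is measured the other way around the circle, where it
           is still at least [del] by the margin at the ends. *)
        rewrite coseven -(cosD2piz `|t - t0| (-1)) -cosN.
        apply: cosmono; first exact: ltW.
          case/andP: tpi => tl tr; case: (leP 0 (t - t0)) tp => ? ?.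
            by rewrite ?ger0_norm //; rewrite rmorphN1; lra.
          by rewrite ?ltr0_norm //; rewrite rmorphN1; lra.
        by rewrite rmorphN1; lra.
      have c2 : 0 <= cos del by rewrite cos_ge0_pihalf //; apply/andP; split; lra.
      rewrite ler_norml /q; have := cos_geN1 (t - t0).
      by have := cos_le1 del; lra.
    have : `|D t * q t ^+ N| <= M.
      rewrite normrM normrX -[leRHS]mulr1; apply: ler_pM => //; first exact: HM.
      exact: exprn_ile1.
    by rewrite ler_norml => /andP[].
  move=> t tin; have tn : `|t - t0| <= del / 2 by rewrite ler_norml; lra.
  have tn' : `|t - t0| <= del by lra.
  have qb : 1 + eta <= q t.
    have : cos (del / 2) <= cos (t - t0) by rewrite [leRHS]coseven; apply: cosmono => //; lra.
    by rewrite /q /eta; lra.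
  apply: ler_pM; [exact: ltW|rewrite exprn_ge0 //; lra|exact: Dbig|].
  by rewrite lerXn2r // nnegrE; lra.
have pos : 0 < D t0 / 2 * del by rewrite mulr_gt0.
move: HN; rewrite ltr_pdivrMr // => HN.
have : 0 <= M * del by rewrite mulr_ge0 // ltW.
by nra.
Qed.

(** [fourier_nonpos] applied to [D] and [- D] settles the open interval; continuity gives the
    endpoint and periodicity the rest. *)
Lemma fourier_unique (D : R -> R) : continuous D ->
  (forall t (m : int), D (t + 2 * pi * m%:~R) = D t) ->
  (forall (k : int) A, aint (fun t => D t * cos (k%:~R * t + A)) = 0) ->
  forall t, D t = 0.
Proof.
move=> Dc Dper D0.
have pi0 := pi_gt0 R.
have inner t : - pi < t < pi -> D t = 0.
  move=> tin; apply/eqP; rewrite eq_le fourier_nonpos //= -oppr_le0.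
  apply: (@fourier_nonpos (fun t => - D t)) => // [u|k A].
    exact: (continuousN (Dc u)).
  have -> : (fun t => - D t * cos (k%:~R * t + A)) =
      (fun t => -1 * (D t * cos (k%:~R * t + A))).
    by apply/funext => u; ring.
  rewrite aintZ ?D0 ?mulr0 // => u.
  exact: (continuousM (Dc u) (@continuous_cos_affine _ _ _ u)).
have Dpi : D (- pi) = 0.
  apply/eqP/negPn/negP => Dn; have n0 : 0 < `|D (- pi)| / 2 by rewrite divr_gt0 ?normr_gt0.
  have /cvgrPdist_le/(_ _ n0) [r /= r0 Hr] := Dc (- pi).
  pose h := Num.min (r / 2) pi.
  have h0 : 0 < h by rewrite lt_min pi0 andbT; lra.
  have hr : h < r by apply: (@le_lt_trans _ _ (r / 2)); [rewrite ge_min lexx|lra].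
  have hp : h <= pi by rewrite ge_min lexx orbT.
  have := Hr (- pi + h); rewrite /ball_ /= (_ : - pi - (- pi + h) = - h); last by ring.
  rewrite normrN gtr0_norm // => /(_ hr).
  rewrite (inner (- pi + h)); last by apply/andP; split; lra.
  by rewrite subr0; have := n0; lra.
move=> t; pose m := Num.floor ((t + pi) / (2 * pi)).
have p2 : 0 < 2 * pi :> R by lra.
have m1 : m%:~R * (2 * pi) <= t + pi by rewrite -ler_pdivlMr // floor_le.
have m2 : t + pi < (m + 1)%:~R * (2 * pi) by rewrite -ltr_pdivrMr // floorD1_gt.
rewrite rmorphD /= in m2.
rewrite -(Dper t (- m)) mulrNz.
have [E|ne] := eqVneq (t + 2 * pi * - m%:~R) (- pi); first by rewrite E.
apply: inner; apply/andP; split; last by lra.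
rewrite lt_neqAle eq_sym ne /=; lra.
Qed.

End FourierUniqueness.

Section PoissonSummation.
Variables (R : realType) (beta : R).
Hypothesis beta_gt0 : 0 < beta.

Definition gaussian (t : R) : R := expR (- (beta / 2) * t ^+ 2).

Lemma gaussian_gt0 t : 0 < gaussian t. Proof. exact: expR_gt0. Qed.
Lemma gaussian_ge0 t : 0 <= gaussian t. Proof. exact: expR_ge0. Qed.

Lemma is_derive_gaussian_shift (u t : R) :
  is_derive t 1 (fun t => gaussian (t + u)) (- beta * (t + u) * gaussian (t + u)).
Proof.
have H1 : is_derive t 1 (fun t : R => 1 * t + u) 1 by exact: is_derive_affine.
have H3 := is_deriveZ (- (beta / 2)) (is_deriveM H1 H1).
have -> : (fun t => gaussian (t + u)) =
    expR \o (- (beta / 2) \*: ((fun t : R => 1 * t + u) * (fun t : R => 1 * t + u))).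
  by apply/funext => v; rewrite /gaussian /= /GRing.scale /= !fctE mul1r expr2.
apply: is_derive_eq (is_derive1_comp (is_derive_expR _) H3) _.
rewrite /gaussian /GRing.scale /= !fctE !mul1r expr2.
by field.
Qed.

Lemma is_derive_gaussian_sin (u s A t : R) :
  is_derive t 1 (fun t => gaussian (t + u) * sin (s * (t + u) + A))
    (- beta * ((t + u) * gaussian (t + u) * sin (s * (t + u) + A)) +
     s * (gaussian (t + u) * cos (s * (t + u) + A))).
Proof.
have -> : (fun t => gaussian (t + u) * sin (s * (t + u) + A)) =
    (fun t => gaussian (t + u)) * (fun t => sin (s * t + (s * u + A))).
  by apply/funext => v; rewrite mulrDr -addrA.
have H := is_deriveM (is_derive_gaussian_shift u t) (is_derive_sin_affine s (s * u + A) t).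
have E : s * (t + u) + A = s * t + (s * u + A) by ring.
by apply: is_derive_eq H _; rewrite E /GRing.scale /=; ring.
Qed.

Lemma continuous_gaussian_shift u : continuous (fun t => gaussian (t + u)).
Proof. exact: is_derive_continuous (is_derive_gaussian_shift u). Qed.

Lemma continuous_gaussian_cos (u s A : R) :
  continuous (fun t => gaussian (t + u) * cos (s * (t + u) + A)).
Proof.
have -> : (fun t => gaussian (t + u) * cos (s * (t + u) + A)) =
    (fun t => gaussian (t + u) * cos (s * t + (s * u + A))).
  by apply/funext => v; rewrite mulrDr -addrA.
by move=> t; exact: (continuousM (@continuous_gaussian_shift u t) (@continuous_cos_affine _ _ _ t)).
Qed.

Lemma continuous_moment_gaussian (u : R) : continuous (fun t => (t + u) * gaussian (t + u)).
Proof.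
have -> : (fun t => (t + u) * gaussian (t + u)) =
    (fun t => (1 * t + u) * gaussian (t + u)).
  by apply/funext => v; rewrite mul1r.
have Ac := is_derive_continuous (is_derive_affine 1 u).
by move=> t; exact: (continuousM (Ac t) (@continuous_gaussian_shift u t)).
Qed.

Lemma continuous_moment_gaussian_sin (u s A : R) :
  continuous (fun t => (t + u) * gaussian (t + u) * sin (s * (t + u) + A)).
Proof.
have -> : (fun t => (t + u) * gaussian (t + u) * sin (s * (t + u) + A)) =
    (fun t => (t + u) * gaussian (t + u) * sin (s * t + (s * u + A))).
  by apply/funext => v; rewrite mulrDr -addrA.
by move=> t; exact: (continuousM (@continuous_moment_gaussian u t) (@continuous_sin_affine _ _ _ t)).
Qed.

(** The Fourier integral over the period translated by [u], written over the fixed interval; the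
    phase [A] handles sines and cosines together. *)
Definition gauss_cos_int (u A s : R) : R :=
  aint (fun t => gaussian (t + u) * cos (s * (t + u) + A)).

Definition gauss_boundary (s A x : R) : R := gaussian x * sin (s * x + A).

(** Differentiation under the integral, the derivative of the integrand being dominated by
    [|(t + u) * gaussian (t + u)|] for every [s]. *)
Lemma is_derive_gauss_cos_int (u A s : R) :
  is_derive s 1 (gauss_cos_int u A)
    (- aint (fun t => (t + u) * gaussian (t + u) * sin (s * (t + u) + A))).
Proof.
pose F (s t : R) := gaussian (t + u) * cos (s * (t + u) + A).
have dF (r t : R) : is_derive r 1 (F ^~ t)
    (- ((t + u) * gaussian (t + u) * sin (r * (t + u) + A))).
  have H := is_deriveZ (gaussian (t + u)) (is_derive_cos_affine (t + u) A r).
  have -> : F^~ t = gaussian (t + u) \*: (fun r : R => cos ((t + u) * r + A)).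
    by apply/funext => v; rewrite /F /= /GRing.scale /= [v * _]mulrC.
  by apply: is_derive_eq; rewrite /GRing.scale /= [r * _]mulrC; ring.
have pd r t : partial1of2 F r t = - ((t + u) * gaussian (t + u) * sin (r * (t + u) + A)).
  by rewrite partial1of2E; have [_ ->] := dF r t.
have sI : `]s - 1, s + 1[%classic s by rewrite /= in_itv /=; apply/andP; split; lra.
have intF r : `]s - 1, s + 1[%classic r ->
    lebesgue_measure.-integrable `[- pi, pi[ (EFin \o F r).
  by move=> _; apply: continuous_integrable_pi; exact: continuous_gaussian_cos.
have derF r t : `]s - 1, s + 1[%classic r -> `[- pi, pi[%classic t -> derivable (F ^~ t) r 1.
  by move=> _ _; have [] := dF r t.
pose H (t : R) := `|(t + u) * gaussian (t + u)|.
have intH : lebesgue_measure.-integrable `[- pi, pi[ (EFin \o H).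
  apply: continuous_integrable_pi => t; apply: cvg_norm.
  exact: continuous_moment_gaussian.
have Hub r t : `]s - 1, s + 1[%classic r -> `[- pi, pi[%classic t ->
    `|partial1of2 F r t| <= H t.
  move=> _ _; rewrite pd normrN normrM /H -[leRHS]mulr1.
  by rewrite ler_pM // sin_max.
have mI := @itv_pi_measurable R.
have D1 := @derivable_under_integral R _ _ (@lebesgue_measure R) F _ mI s (s - 1) (s + 1) sI intF derF H
  (fun t => normr_ge0 _) intH Hub.
have D2 := @differentiation_under_integral R _ _ (@lebesgue_measure R) F _ mI s (s - 1) (s + 1) sI intF derF H
  (fun t => normr_ge0 _) intH Hub.
split; first exact: D1.
rewrite -derive1E; apply: etrans D2 _.
rewrite -[RHS]mulN1r -aintZ; last exact: continuous_moment_gaussian_sin.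
by apply: eq_Rintegral => t _; rewrite pd mulN1r.
Qed.

(** Integrate the derivative of [gaussian x * sin (s * x + A)], using that the derivative of the
    Gaussian is [- beta * x] times itself. *)
Lemma gauss_cos_int_parts (u A s : R) :
  beta * - aint (fun t => (t + u) * gaussian (t + u) * sin (s * (t + u) + A))
    + s * gauss_cos_int u A s =
  gauss_boundary s A (pi + u) - gauss_boundary s A (- pi + u).
Proof.
have c1 := @continuous_moment_gaussian_sin u s A.
have c2 := @continuous_gaussian_cos u s A.
have scalec (c : R) (g : R -> R) : continuous g -> continuous (fun t => c * g t).
  by move=> gc t; exact: (continuousM (@continuous_cst_fun _ c t) (gc t)).
have dc : continuous (fun t => - beta * ((t + u) * gaussian (t + u) * sin (s * (t + u) + A)) +
     s * (gaussian (t + u) * cos (s * (t + u) + A))).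
  by move=> t; exact: (continuousD (scalec _ _ c1 t) (scalec _ _ c2 t)).
have := aint_FTC dc (is_derive_gaussian_sin u s A).
rewrite aintD; [|exact: scalec|exact: scalec].
by rewrite !aintZ // /gauss_boundary => <-; rewrite mulrN mulNr.
Qed.

Let node (m : int) : R := 2 * pi * m%:~R.

(** The translated periods tile an interval of half-length [(2 * M + 1) * pi], and the inner
    endpoints cancel. *)
Lemma sum_symrange_telescope (J : R -> R) M :
  \sum_(m <- symrange M) (J (pi + node m) - J (- pi + node m)) =
  J ((2 * M + 1)%:R * pi) - J (- ((2 * M + 1)%:R * pi)).
Proof.
rewrite sum_symrange /node; elim: M => [|M IH].
  by rewrite big_ord0 !mulr0 !addr0 mul1r.
rewrite big_ord_recr /= addrA IH NegzE !mulrNz.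
rewrite -[M.+1%:~R]/(M.+1%:R).
have -> : pi + 2 * pi * M.+1%:R = (2 * M.+1 + 1)%:R * pi :> R.
  by rewrite !natrD !natrM; ring.
have -> : - pi + 2 * pi * M.+1%:R = (2 * M + 1)%:R * pi :> R.
  by rewrite -[M.+1%:R]natr1 natrD natrM; ring.
have -> : pi + 2 * pi * - M.+1%:R = - ((2 * M + 1)%:R * pi) :> R.
  by rewrite -[M.+1%:R]natr1 natrD natrM; ring.
have -> : - pi + 2 * pi * - M.+1%:R = - ((2 * M.+1 + 1)%:R * pi) :> R.
  by rewrite !natrD !natrM; ring.
ring.
Qed.

Let L (M : nat) : R := (2 * M + 1)%:R * pi.

Definition wrapped_int (M : nat) (A s : R) : R :=
  \sum_(m <- symrange M) gauss_cos_int (node m) A s.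

Lemma is_derive_sum_seq (I : Type) (r : seq I) (f : I -> R -> R) (df : I -> R) (t : R) :
  (forall i, is_derive t 1 (f i) (df i)) ->
  is_derive t 1 (fun t => \sum_(i <- r) f i t) (\sum_(i <- r) df i).
Proof.
move=> fd; elim: r => [|i r IH].
  rewrite big_nil; under eq_fun do rewrite big_nil; exact: is_derive_cst.
rewrite big_cons; under eq_fun do rewrite big_cons.
exact: is_deriveD.
Qed.

(* Integration by parts over [-L M, L M]: up to boundary terms the Fourier
   transform of the Gaussian satisfies [beta f' = - s f]. *)
Lemma wrapped_int_derive M (A s : R) : is_derive s 1 (wrapped_int M A)
  (beta^-1 * (gauss_boundary s A (L M) - gauss_boundary s A (- L M) - s * wrapped_int M A s)).
Proof.
have H := is_derive_sum_seq (symrange M) (fun m => is_derive_gauss_cos_int (node m) A s).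
apply: is_derive_eq H _.
rewrite /L -sum_symrange_telescope /wrapped_int mulr_sumr -sumrB mulr_sumr.
apply: eq_bigr => m _; rewrite -gauss_cos_int_parts.
by have := lt0r_neq0 beta_gt0; move=> ?; field.
Qed.

(** With the integrating factor [expR (s ^+ 2 / (2 * beta))] only boundary terms remain in the
    derivative, at most [2 / beta * gaussian (L M)] times that factor; conclude by the mean value
    theorem on [[0, k]]. *)
Lemma wrapped_int_decay M A (k : R) : 0 <= k ->
  `|wrapped_int M A k * expR (k ^+ 2 / (2 * beta)) - wrapped_int M A 0| <=
  2 / beta * gaussian (L M) * expR (k ^+ 2 / (2 * beta)) * k.
Proof.
move=> k0; have bn := lt0r_neq0 beta_gt0.
pose E s := wrapped_int M A s * expR (s ^+ 2 / (2 * beta)).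
pose dE s := beta^-1 * (gauss_boundary s A (L M) - gauss_boundary s A (- L M)) *
  expR (s ^+ 2 / (2 * beta)).
have Ed (s : R) : is_derive s 1 E (dE s).
  have H3 := is_deriveZ ((2 * beta)^-1) (is_deriveM (is_derive_id s 1) (is_derive_id s 1)).
  have H5 := is_deriveM (wrapped_int_derive M A s) (is_derive1_comp (is_derive_expR _) H3).
  have -> : E = wrapped_int M A * (expR \o ((2 * beta)^-1 \*: ((id : R -> R) * id))).
    apply/funext => v; rewrite /E /=; congr (_ * expR _).
    by rewrite /GRing.scale /= !fctE expr2 mulrC.
  apply: is_derive_eq H5 _.
  rewrite /dE /GRing.scale /= !fctE expr2.
  rewrite [_ / (2 * beta)]mulrC; field.
  by rewrite bn.
have [c /andP[c0 ck] Ec] : exists2 c, 0 <= c <= k & E k - E 0 = dE c * (k - 0).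
  have Ec : continuous E := is_derive_continuous Ed.
  have := @MVT_segment _ E dE 0 k k0 (fun s _ => Ed s) (continuous_subspaceT Ec).
  by case=> c; rewrite in_itv /= => ? ?; exists c.
have E0 : E 0 = wrapped_int M A 0 by rewrite /E expr0n mul0r expR0 mulr1.
rewrite -E0 -/(E k) Ec subr0 normrM (ger0_norm k0) ler_wpM2r //.
rewrite /dE normrM (gtr0_norm (expR_gt0 _)).
apply: ler_pM; rewrite ?normr_ge0 ?expR_ge0 //.
  rewrite normrM gtr0_norm ?invr_gt0 //.
  have -> : 2 / beta * gaussian (L M) = beta^-1 * (gaussian (L M) + gaussian (L M)).
    by field.
  rewrite ler_pM2l ?invr_gt0 //; apply: le_trans (ler_normB _ _) _.
  have bd x : gaussian x = gaussian (L M) -> `|gauss_boundary c A x| <= gaussian (L M).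
    move=> E1; rewrite normrM E1 (gtr0_norm (gaussian_gt0 _)) -[leRHS]mulr1.
    by rewrite ler_pM2l ?gaussian_gt0 // sin_max.
  by rewrite lerD // bd // /gaussian sqrrN.
rewrite ler_expR ler_pM2r ?invr_gt0 ?mulr_gt0 //.
by rewrite lerXn2r // nnegrE.
Qed.

Lemma symrange_sub N M : (N <= M)%N -> {subset symrange N <= symrange M}.
Proof. by move=> NM i; rewrite !mem_symrange => /leq_trans; apply. Qed.

Lemma symrange_sum_cvg (w : int -> R) (C : R) : (forall i, 0 <= w i) ->
  (forall N, \sum_(i <- symrange N) w i <= C) ->
  \sum_(i <- symrange N) w i @[N --> \oo] --> fine (\esum_(i in [set: int]) (w i)%:E)%E.
Proof.
move=> w0 wC; apply: (exhaustion_sum_cvg (C := C) _ _ _ w0 wC).2 => //.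
  exact: uniq_symrange.
by move=> i _; exists `|i|%N => N iN; rewrite mem_symrange.
Qed.

Lemma symrange_sum_tail (w b : int -> R) (W l : R) : (forall i, - w i <= b i <= w i) ->
  \sum_(i <- symrange N) w i @[N --> \oo] --> W ->
  \sum_(i <- symrange N) b i @[N --> \oo] --> l ->
  forall N, `|l - \sum_(i <- symrange N) b i| <= W - \sum_(i <- symrange N) w i.
Proof.
move=> bw wW bl N.
have c1 : `|\sum_(i <- symrange M) b i - \sum_(i <- symrange N) b i| @[M --> \oo] -->
    `|l - \sum_(i <- symrange N) b i|.
  by apply: cvg_norm; apply: cvgB; [exact: bl|exact: cvg_cst].
have c2 : \sum_(i <- symrange M) w i - \sum_(i <- symrange N) w i @[M --> \oo] -->
    W - \sum_(i <- symrange N) w i.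
  by apply: cvgB; [exact: wW|exact: cvg_cst].
apply: ler_cvg_to c1 c2 _; exists N => // M /= NM.
by apply: ler_norm_sum_tail; rewrite ?uniq_symrange //; exact: symrange_sub.
Qed.

Lemma continuous_scale (c : R) (g : R -> R) : continuous g -> continuous (fun t => c * g t).
Proof. by move=> gc t; exact: (continuousM (@continuous_cst_fun _ c t) (gc t)). Qed.

Lemma continuous_mul_cos (f : R -> R) (k A : R) : continuous f ->
  continuous (fun t => f t * cos (k * t + A)).
Proof. by move=> fc t; exact: (continuousM (fc t) (@continuous_cos_affine _ k A t)). Qed.

Lemma continuous_sub_scale (c : R) (f g : R -> R) : continuous f -> continuous g ->
  continuous (fun t => f t - c * g t).
Proof. by move=> fc gc t; exact: (continuousB (fc t) (@continuous_scale c g gc t)). Qed.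

Lemma aint_cvg (f : R -> R) (g : nat -> R -> R) (eps : nat -> R) :
  continuous f -> (forall N, continuous (g N)) ->
  (forall N t, - pi <= t < pi -> `|f t - g N t| <= eps N) ->
  eps N @[N --> \oo] --> 0 -> aint (g N) @[N --> \oo] --> aint f.
Proof.
move=> fc gc fg eps0; apply/cvgrPdist_le => e e0.
have p0 : 0 < 2 * pi :> R by rewrite mulr_gt0 ?pi_gt0.
have /cvgrPdist_le/(_ _ (divr_gt0 e0 p0)) := eps0.
apply: filterS => N /=; rewrite sub0r normrN => epsN.
rewrite -aintB //; apply: le_trans (aint_norm_le (C := eps N) _ _) _.
- by move=> t; exact: (continuousB (fc t) (gc N t)).
- exact: fg.
- by rewrite mulrC -ler_pdivlMr //; exact: le_trans (ler_norm _) epsN.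
Qed.

Let wt (i : int) : R := gauss_int (beta * pi ^+ 2) i.

(** From the identity [(t + 2 pi m)^2 = 2 pi^2 m^2 - t^2 + 2 (t + pi m)^2]; this is the origin of
    the rate [beta * pi ^+ 2] in [wt]. *)
Lemma gaussian_node_le (A t : R) m : `|t| <= A ->
  gaussian (t + node m) <= expR (beta / 2 * A ^+ 2) * wt m.
Proof.
move=> tA; rewrite /wt /gauss_int -expRD ler_expR /node.
have : t ^+ 2 <= A ^+ 2 by rewrite -real_normK ?num_real // lerXn2r // nnegrE // (le_trans _ tA).
move=> tA2.
have : 0 <= beta * (A ^+ 2 - t ^+ 2) by rewrite mulr_ge0 ?subr_ge0 // ltW.
have : 0 <= beta * (t + pi * m%:~R) ^+ 2 by rewrite mulr_ge0 ?sqr_ge0 // ltW.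
by nra.
Qed.

Let wt_bounded : exists C, forall N, \sum_(i <- symrange N) wt i <= C.
Proof. by apply: gauss_int_bounded; rewrite mulr_gt0 // exprn_gt0 // pi_gt0. Qed.

Let Winf : R := fine (\esum_(i in [set: int]) (wt i)%:E)%E.

Let wt_cvg : \sum_(i <- symrange N) wt i @[N --> \oo] --> Winf.
Proof.
have [C HC] := wt_bounded; apply: symrange_sum_cvg HC => i; exact: gauss_int_ge0.
Qed.

Definition gauss_sum (M : nat) (t : R) : R := \sum_(m <- symrange M) gaussian (t + node m).

Lemma villain_edge_cvg t : gauss_sum M t @[M --> \oo] --> villain_edge beta t.
Proof.
have [C HC] := wt_bounded.
apply: (@symrange_sum_cvg _ (expR (beta / 2 * `|t| ^+ 2) * C)) => [m|N].
  exact: gaussian_ge0.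
apply: (@le_trans _ _ (\sum_(i <- symrange N) expR (beta / 2 * `|t| ^+ 2) * wt i)).
  by apply: ler_sum => i _; exact: gaussian_node_le.
by rewrite -mulr_sumr ler_pM2l ?expR_gt0.
Qed.

Lemma villain_edge_tail (A t : R) N : `|t| <= A ->
  `|villain_edge beta t - gauss_sum N t| <=
  expR (beta / 2 * A ^+ 2) * (Winf - \sum_(i <- symrange N) wt i).
Proof.
move=> tA; rewrite mulrBr mulr_sumr.
apply: (symrange_sum_tail (w := fun i => expR (beta / 2 * A ^+ 2) * wt i)).
- move=> i; rewrite gaussian_node_le // andbT.
  apply: (@le_trans _ _ 0); last exact: gaussian_ge0.
  by rewrite oppr_le0 mulr_ge0 ?expR_ge0 // gauss_int_ge0.
- by under eq_fun do rewrite -mulr_sumr; apply: cvgM; [exact: cvg_cst|exact: wt_cvg].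
- exact: villain_edge_cvg.
Qed.

Let tail_cvg (c : R) : c * (Winf - \sum_(i <- symrange N) wt i) @[N --> \oo] --> 0.
Proof.
rewrite -[X in _ --> X](mulr0 c) -[X in c * X](subrr Winf).
by apply: cvgM; [exact: cvg_cst|apply: cvgB; [exact: cvg_cst|exact: wt_cvg]].
Qed.

Lemma continuous_gauss_sum M : continuous (gauss_sum M).
Proof. apply: continuous_sum => m; exact: continuous_gaussian_shift. Qed.

Lemma continuous_villain_edge : continuous (villain_edge beta).
Proof.
apply: continuous_locally_unif => A eps eps0.
have /cvgrPdist_le/(_ _ eps0) [N _ HN] := tail_cvg (expR (beta / 2 * A ^+ 2)).
exists (gauss_sum N); split; first exact: continuous_gauss_sum.
move=> t tA; apply: le_trans (villain_edge_tail N tA) _.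
by have := HN N (leqnn N); rewrite /= sub0r normrN; apply/le_trans/ler_norm.
Qed.

Lemma villain_edge_periodic t (j : int) :
  villain_edge beta (t + 2 * pi * j%:~R) = villain_edge beta t.
Proof.
rewrite /villain_edge; congr fine.
rewrite [RHS](reindex_esum [set: int] _ (fun m => m + j)).
  by apply: eq_esum => m _; congr (expR (_ * _ ^+ 2))%:E; rewrite rmorphD /=; ring.
split=> // [m n _ _ /addIr //|m _]; exists (m - j) => //; by rewrite subrK.
Qed.

Let c0 : R := aint (villain_edge beta).

Let c0_gt0 : 0 < c0.
Proof.
have pi2 := pi_ge2 R.
have low t : gaussian t <= villain_edge beta t.
  apply: (ler_cvg_to (cvg_cst (gaussian t)) (@villain_edge_cvg t)).
  apply: nearW => M.
  have := @ler_sum_subset _ _ (symrange 0) (symrange M) (fun m => gaussian (t + node m))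
    (uniq_symrange 0) (uniq_symrange M) (symrange_sub (leq0n M)) (fun m => gaussian_ge0 _).
  by rewrite big_seq1 /node mulr0 addr0.
have := @aint_ge_interval R (villain_edge beta) 0 1 (expR (- (beta / 2))) 0 continuous_villain_edge.
rewrite mulr0 subr0 addr0 subr0 mulr1 => H.
apply: lt_le_trans (H _ _ _ _ _ _); [exact: expR_gt0|lra|lra|lra|lra| |].
  by move=> t _; rewrite oppr0; apply: le_trans (low t); exact: gaussian_ge0.
move=> t /andP[t0 t1]; apply: le_trans (low t).
have t2 : t ^+ 2 <= 1 by rewrite expr_le1.
have : 0 <= beta * (1 - t ^+ 2) by rewrite mulr_ge0 ?subr_ge0 // ltW.
by rewrite /gaussian ler_expR; lra.
Qed.

(** For an integer frequency, translation by [2 * pi * m] does not change the phase, so the wrapped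
    Gaussian and the Gaussian on the line have the same integral. *)
Lemma wrapped_intE M A (k : int) :
  aint (fun t => gauss_sum M t * cos (k%:~R * t + A)) = wrapped_int M A k%:~R.
Proof.
rewrite /wrapped_int /gauss_cos_int -aint_sum; last by move=> m; exact: continuous_gaussian_cos.
congr aint; apply/funext => t; rewrite /gauss_sum mulr_suml; apply: eq_bigr => m _.
congr (_ * _); rewrite -(cosD2piz (k%:~R * t + A) (k * m)); congr cos.
by rewrite /node rmorphM /=; ring.
Qed.

Lemma gaussian_node_cvg0 (C : R) : 2 / beta * gaussian (L M) * C @[M --> \oo] --> 0.
Proof.
have bd M : 0 <= gaussian (L M) <= 2 / beta * M.+1%:R^-1.
  rewrite gaussian_ge0 /=; have L1 : M.+1%:R <= L M.
    rewrite /L; have := pi_ge2 R => p2; apply: (@le_trans _ _ ((2 * M + 1)%:R * 1)).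
      by rewrite mulr1 ler_nat; lia.
    by rewrite ler_pM2l ?ltr0n ?addn1 //; lra.
  have M1 : 1 <= M.+1%:R :> R by rewrite ler1n.
  have y0 : 0 < beta / 2 * M.+1%:R by rewrite mulr_gt0 ?divr_gt0 // ltr0n.
  have y1 : beta / 2 * M.+1%:R <= beta / 2 * L M ^+ 2.
    by rewrite ler_pM2l ?divr_gt0 //; nra.
  have e1 := expR_ge1Dx (beta / 2 * L M ^+ 2).
  rewrite /gaussian mulNr expRN.
  have -> : 2 / beta / M.+1%:R = (beta / 2 * M.+1%:R)^-1.
    by rewrite invfM invf_div.
  by rewrite lef_pV2 ?posrE ?expR_gt0 //; lra.
have g0 : gaussian (L M) @[M --> \oo] --> 0.
  apply: (@squeeze_cvgr _ _ _ _ (fun=> 0) (fun M => 2 / beta * M.+1%:R^-1)).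
  - exact: nearW.
  - exact: cvg_cst.
  - rewrite -[X in _ --> X](mulr0 (2 / beta)).
    by apply: cvgM; [exact: cvg_cst|exact: cvg_harmonic].
have -> : 0 = 2 / beta * 0 * C by rewrite mulr0 mul0r.
by apply: cvgM; [apply: cvgM; [exact: cvg_cst|exact: g0]|exact: cvg_cst].
Qed.

(** As [M] grows the boundary terms in [wrapped_int_decay] vanish, so the coefficient at [k] times
    [expR (k ^+ 2 / (2 * beta))] is the one at zero. The total mass [c0] stays symbolic. *)
Lemma villain_edge_coef (k : int) A :
  aint (fun t => villain_edge beta t * cos (k%:~R * t + A)) =
  gauss_int (beta^-1 / 2) k * (cos A * c0).
Proof.
wlog k0 : k A / 0 <= k.
  move=> W; have [/W -> //|k0] := leP 0 k.
  rewrite -gauss_int_even -[cos A]cosN -W ?oppr_ge0 ?ltW //; congr aint.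
  by apply/funext => t; congr (_ * _); rewrite -[RHS]cosN; congr cos; rewrite mulrNz; ring.
have coefc (j : int) B : wrapped_int M B j%:~R @[M --> \oo] -->
    aint (fun t => villain_edge beta t * cos (j%:~R * t + B)).
  under eq_fun do rewrite -wrapped_intE.
  apply: (aint_cvg _ _ _ (@tail_cvg (expR (beta / 2 * pi ^+ 2)))).
  - exact: continuous_mul_cos continuous_villain_edge.
  - move=> N; exact: continuous_mul_cos (@continuous_gauss_sum N).
  - move=> N t /andP[t1 t2]; rewrite -mulrBl normrM -[leRHS]mulr1.
    rewrite ler_pM ?cos_max //; apply: villain_edge_tail.
    by rewrite ler_norml t1 ltW.
have k0R : 0 <= k%:~R :> R by rewrite ler0z.
set e := expR (k%:~R ^+ 2 / (2 * beta)).
have lim0 : aint (fun t => villain_edge beta t * cos (k%:~R * t + A)) * e =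
    aint (fun t => villain_edge beta t * cos (0%:~R * t + A)).
  apply/eqP; rewrite -subr_eq0 -normr_le0.
  have c1 : `|wrapped_int M A k%:~R * e - wrapped_int M A 0%:~R| @[M --> \oo] -->
    `|aint (fun t => villain_edge beta t * cos (k%:~R * t + A)) * e -
      aint (fun t => villain_edge beta t * cos (0%:~R * t + A))|.
    apply: cvg_norm; apply: cvgB; last exact: coefc.
    by apply: cvgM; [exact: coefc|exact: cvg_cst].
  apply: (ler_cvg_to c1 (@gaussian_node_cvg0 (e * k%:~R))); apply: nearW => M.
  by rewrite mulrA; exact: wrapped_int_decay.
have E0 : aint (fun t => villain_edge beta t * cos (0%:~R * t + A)) = cos A * c0.
  rewrite /c0 -aintZ; last exact: continuous_villain_edge.
  by congr aint; apply/funext => t; rewrite mul0r add0r mulrC.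
have e0 : e != 0 by rewrite gt_eqF // expR_gt0.
rewrite -[LHS](mulfK e0) lim0 E0 mulrC; congr (_ * _).
rewrite /e /gauss_int -expRN; congr expR; field; exact: lt0r_neq0.
Qed.

Let a (i : int) : R := gauss_int (beta^-1 / 2) i.

Let a_bounded : exists C, forall N, \sum_(i <- symrange N) a i <= C.
Proof. by apply: gauss_int_bounded; rewrite divr_gt0 ?invr_gt0. Qed.

Let Ainf : R := fine (\esum_(i in [set: int]) (a i)%:E)%E.

Let a_cvg : \sum_(i <- symrange N) a i @[N --> \oo] --> Ainf.
Proof.
have [C HC] := a_bounded; apply: symrange_sum_cvg HC => i; exact: gauss_int_ge0.
Qed.

Let gN (N : nat) (t : R) : R := \sum_(i <- symrange N) a i * cos (i%:~R * t).

(** The cosine series with coefficients [a]: adding 1 to each cosine makes the terms nonnegative, as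
    [esum] expects, and [Ainf] removes the surplus. *)
Let g (t : R) : R :=
  fine (\esum_(i in [set: int]) (a i * (1 + cos (i%:~R * t)))%:E)%E - Ainf.

Let g_cvg t : gN N t @[N --> \oo] --> g t.
Proof.
have [C HC] := a_bounded.
have -> : gN^~ t = (fun N => \sum_(i <- symrange N) a i * (1 + cos (i%:~R * t)) -
    \sum_(i <- symrange N) a i).
  apply/funext => N; rewrite -sumrB; apply: eq_bigr => i _.
  by rewrite mulrDr mulr1 addrC addKr.
apply: cvgB; last exact: a_cvg.
apply: (@symrange_sum_cvg _ (C * 2)) => [i|N].
  rewrite mulr_ge0 ?gauss_int_ge0 //; have := cos_geN1 (i%:~R * t); lra.
apply: (@le_trans _ _ (\sum_(i <- symrange N) a i * 2)).
  apply: ler_sum => i _; rewrite ler_wpM2l ?gauss_int_ge0 //.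
  by have := cos_le1 (i%:~R * t); lra.
by rewrite -mulr_suml ler_pM2r.
Qed.

Let g_tail t N : `|g t - gN N t| <= Ainf - \sum_(i <- symrange N) a i.
Proof.
apply: symrange_sum_tail a_cvg (@g_cvg t) N => i.
rewrite -ler_norml normrM ger0_norm ?gauss_int_ge0 //.
by rewrite ler_piMr ?gauss_int_ge0 // cos_max.
Qed.

Let cos_lin (i : int) : continuous (fun t : R => cos (i%:~R * t)).
Proof.
by have := @continuous_cos_affine R i%:~R 0; under eq_fun do rewrite addr0.
Qed.

Let gN_continuous N : continuous (gN N).
Proof. by apply: continuous_sum => i; apply: continuous_scale; exact: cos_lin. Qed.

Let a_tail_cvg : Ainf - \sum_(i <- symrange N) a i @[N --> \oo] --> 0.
Proof. by rewrite -[X in _ --> X](subrr Ainf); apply: cvgB; [exact: cvg_cst|exact: a_cvg]. Qed.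

Let g_continuous : continuous g.
Proof.
apply: continuous_unif => eps eps0.
have /cvgrPdist_le/(_ _ eps0) [N _ HN] := a_tail_cvg.
exists (gN N); split; first exact: gN_continuous.
move=> t; apply: le_trans (g_tail t N) _.
by have := HN N (leqnn N); rewrite /= sub0r normrN; apply/le_trans/ler_norm.
Qed.

Let g_periodic t (m : int) : g (t + 2 * pi * m%:~R) = g t.
Proof.
apply: (cvg_unique _ (@g_cvg _) (_ : gN N (t + 2 * pi * m%:~R) @[N --> \oo] --> g t)).
  exact: norm_hausdorff.
have -> : gN^~ (t + 2 * pi * m%:~R) = gN^~ t; last exact: g_cvg.
apply/funext => N; apply: eq_bigr => i _; congr (_ * _).
rewrite -(cosD2piz (i%:~R * t) (i * m)); congr cos.
by rewrite rmorphM /=; ring.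
Qed.

Let sum_symrange_delta N (k : int) : (`|k| <= N)%N ->
  \sum_(i <- symrange N) a i * (i == k)%:R = a k.
Proof.
move=> kN; rewrite (bigD1_seq k) ?uniq_symrange ?mem_symrange //= eqxx mulr1.
by rewrite big1 ?addr0 // => i /negPf ->; rewrite mulr0.
Qed.

Let g_coef (k : int) A : aint (fun t => g t * cos (k%:~R * t + A)) = 2 * pi * (a k * cos A).
Proof.
have c1 : aint (fun t => gN N t * cos (k%:~R * t + A)) @[N --> \oo] -->
    aint (fun t => g t * cos (k%:~R * t + A)).
  apply: (aint_cvg _ _ _ a_tail_cvg).
  - exact: continuous_mul_cos g_continuous.
  - move=> N; exact: continuous_mul_cos (@gN_continuous N).
  - move=> N t _; rewrite -mulrBl normrM -[leRHS]mulr1.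
    by rewrite ler_pM ?cos_max //; exact: g_tail.
apply: (cvg_unique _ c1); first exact: norm_hausdorff.
apply: cvg_near_cst; exists `|k|%N => // N /= kN.
have cosc (j : int) B := @continuous_cos_affine R j%:~R B.
have -> : (fun t => gN N t * cos (k%:~R * t + A)) =
    (fun t => \sum_(i <- symrange N) (a i / 2 * cos ((k + i)%:~R * t + A) +
                                     a i / 2 * cos ((k - i)%:~R * t + A))).
  apply/funext => t; rewrite /gN mulr_suml; apply: eq_bigr => i _.
  have -> : (k + i)%:~R * t + A = (k%:~R * t + A) + i%:~R * t by rewrite rmorphD /=; ring.
  have -> : (k - i)%:~R * t + A = (k%:~R * t + A) - i%:~R * t by rewrite rmorphB /=; ring.
  by move: (k%:~R * t + A) (i%:~R * t) => u v; rewrite cosD cosB; field.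
rewrite aint_sum; last first.
  move=> i t; exact: (continuousD (@continuous_scale _ _ (@cosc _ _) t)
    (@continuous_scale _ _ (@cosc _ _) t)).
(* Among the frequencies [k + i] and [k - i] only the zero ones survive, at [i = - k] and [i = k];
   [a] being even, the two halves add up. *)
rewrite (eq_bigr (fun i => pi * cos A * (a i * (i == - k)%:R + a i * (i == k)%:R))).
  rewrite -mulr_sumr big_split /= !sum_symrange_delta ?abszN //.
  by rewrite /a gauss_int_even; ring.
move=> i _; rewrite aintD; [|exact/continuous_scale/cosc|exact/continuous_scale/cosc].
rewrite !aintZ; [|exact: cosc|exact: cosc]; rewrite !aint_cos.
have -> : (k + i == 0) = (i == - k) by rewrite addrC addr_eq0.
have -> : (k - i == 0) = (i == k) by rewrite subr_eq0 eq_sym.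
by field.
Qed.

Lemma villain_edge_fourier : exists2 c : R, 0 < c & forall t,
  \sum_(i <- symrange N) gauss_int (beta^-1 / 2) i * cos (i%:~R * t) @[N --> \oo] -->
  villain_edge beta t / c.
Proof.
have p0 : 0 < 2 * pi :> R by rewrite mulr_gt0 ?pi_gt0.
(* The ratio of the coefficients found in [villain_edge_coef] and in [g_coef], the same for every
   [k]. *)
pose c := c0 / (2 * pi); have cpos : 0 < c := divr_gt0 c0_gt0 p0.
exists c => // t.
suff -> : villain_edge beta t / c = g t by exact: g_cvg.
apply: (mulIf (lt0r_neq0 cpos)); rewrite divfK ?lt0r_neq0 // mulrC.
apply/eqP; rewrite -subr_eq0; apply/eqP.
apply: (@fourier_unique R (fun t => villain_edge beta t - c * g t)) => [|u m|k A].
- exact: continuous_sub_scale continuous_villain_edge g_continuous.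
- by rewrite villain_edge_periodic g_periodic.
have -> : (fun u => (villain_edge beta u - c * g u) * cos (k%:~R * u + A)) =
    (fun u => villain_edge beta u * cos (k%:~R * u + A) - c * (g u * cos (k%:~R * u + A))).
  by apply/funext => u; ring.
have gc : continuous (fun u => g u * cos (k%:~R * u + A)).
  exact: continuous_mul_cos g_continuous.
rewrite aintB; last exact: continuous_scale.
  rewrite aintZ // villain_edge_coef g_coef /c /a.
  by rewrite [X in _ - X]mulrA divfK ?(lt0r_neq0 p0) //; ring.
exact: continuous_mul_cos continuous_villain_edge.
Qed.

End PoissonSummation.

(** * The dual representation of the correlation *)

Section CurrentSums.
Variables (R : realType) (G : planeGraph) (lam : R).
Hypothesis lam_gt0 : 0 < lam.

Local Notation E := (enum (edge G)).
Implicit Types (k : {ffun edge G -> int}) (g : edge G -> int).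

Definition current_weight k : R := \prod_(a <- E) gauss_int (lam / 2) (k a).

Lemma current_weight_ge0 k : 0 <= current_weight k.
Proof. by apply: prodr_ge0 => a _; exact: gauss_int_ge0. Qed.

Lemma divergence_gradient g (n : height G) v :
  divergence (gradient g n) v = - divergence g v.
Proof.
rewrite -[RHS]add0r -(divergence_coboundary n v) /divergence.
under eq_bigr do rewrite ffunE.
under [X in _ - X]eq_bigr do rewrite ffunE.
by rewrite !sumrB; ring.
Qed.

(** [gradient g] is a bijection from Dirichlet heights onto currents of divergence [- divergence g]:
    one-to-one because the faces are connected, onto by [divergence_free_coboundary]. *)
Lemma current_sum_cvg g :
  (\esum_(n in @dirichlet G) (gradient_weight lam predT g n)%:E < +oo)%E /\
  \sum_(k <- box E (symrange N) [ffun=> 0])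
    current_weight k * [forall v, divergence k v == - divergence g v]%:R @[N --> \oo]
  --> fine (\esum_(n in @dirichlet G) (gradient_weight lam predT g n)%:E)%E.
Proof.
pose D := [set k : {ffun edge G -> int} | [forall v, divergence k v == - divergence g v]].
pose a k := current_weight k * (k \in D)%:R.
have aE k : current_weight k * [forall v, divergence k v == - divergence g v]%:R = a k.
  rewrite /a; congr (_ * _%:R); congr (nat_of_bool _).
  by apply/idP/idP => [Dk|/set_mem //]; apply/mem_set.
have a0 k : 0 <= a k by rewrite mulr_ge0 ?current_weight_ge0.
have -> : (\esum_(n in @dirichlet G) (gradient_weight lam predT g n)%:E)%E =
    (\esum_(k in pinned E [ffun=> 0%R]) (a k)%:E)%E.
  transitivity (\esum_(k in D) (current_weight k)%:E)%E.
    rewrite (reindex_esum (@dirichlet G) D (gradient g)).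
      by apply: eq_esum => n _; rewrite gradient_weight_prod.
    split.
    - by move=> n _; apply/forallP => v; rewrite divergence_gradient.
    - move=> n m /set_mem n0 /set_mem m0 nm; apply: gradient_inj nm.
      by rewrite (n0 : n (outer G) = 0) (m0 : m (outer G) = 0).
    - move=> k /forallP Dk.
      have [v|h [h_out hE]] := @divergence_free_coboundary G (fun a => k a + g a).
        rewrite /divergence !big_split /= opprD addrACA -!/(divergence _ v).
        by rewrite (eqP (Dk v)) addNr.
      exists [ffun f => h f]; first by rewrite /dirichlet ffunE.
      apply/ffunP => e; rewrite ffunE /coboundary !ffunE -/(coboundary h (e, true)).
      by rewrite -hE addrK.
  rewrite esum_mkcond (_ : pinned E _ = setT).
    by apply: eq_esum => k _; rewrite /a; case: ifP; rewrite ?mulr1 ?mulr0.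
  by apply/seteqP; split=> // k _ e; rewrite mem_enum.
set z0 : {ffun edge G -> int} := [ffun=> 0].
have -> : (fun N => \sum_(k <- box E (symrange N) z0)
    current_weight k * [forall v, divergence k v == - divergence g v]%:R) =
    (fun N => \sum_(k <- box E (symrange N) z0) a k).
  by apply/funext => N; apply: eq_bigr => k _; exact: aE.
have [C HC] := prod_gauss_bounded G lam_gt0.
apply: (@box_sum_cvg _ _ _ _ _ C) => // [|N]; first exact: enum_uniq.
apply: le_trans (HC _ (uniq_box [ffun=> 0] (enum_uniq (edge G)) (uniq_symrange N))).
apply: ler_sum => k _; rewrite /a -/(current_weight k).
by rewrite ler_piMr ?current_weight_ge0 // lern1 leq_b1.
Qed.

(** Reflection [n -> - n]; it identifies the two terms that [cos (theta x - theta y)] produces. *)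
Lemma esum_gradient_weightN g :
  (\esum_(n in @dirichlet G) (gradient_weight lam predT (fun a => - g a) n)%:E =
   \esum_(n in @dirichlet G) (gradient_weight lam predT g n)%:E)%E.
Proof.
rewrite (reindex_esum (@dirichlet G) (@dirichlet G)
   (fun n : height G => [ffun f => - n f] : height G)); last first.
  split.
  - by move=> n n0; rewrite /dirichlet ffunE n0.
  - move=> n m _ _ /ffunP nm; apply/ffunP => f; have := nm f; rewrite !ffunE.
    exact: oppr_inj.
  - move=> n n0; exists [ffun f => - n f]; first by rewrite /dirichlet ffunE n0.
    by apply/ffunP => f; rewrite !ffunE opprK.
apply: eq_esum => n _; rewrite /gradient_weight; congr (expR _)%:E; congr (_ * _).
apply: eq_bigr => a _; rewrite -[RHS]sqrrN -mulrNz /coboundary !ffunE.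
by congr (_%:~R ^+ 2); ring.
Qed.

End CurrentSums.

Lemma cvg_prod_seq (R : realType) (I : Type) (r : seq I) (f : I -> nat -> R) (l : I -> R) :
  (forall i, f i N @[N --> \oo] --> l i) ->
  \prod_(i <- r) f i N @[N --> \oo] --> \prod_(i <- r) l i.
Proof.
move=> fl; elim: r => [|i r IH].
  by rewrite big_nil; under eq_fun do rewrite big_nil; exact: cvg_cst.
rewrite big_cons; under eq_fun do rewrite big_cons.
exact: cvgM.
Qed.

Section DualRepresentation.
Variables (R : realType) (G : planeGraph) (beta : R).
Hypothesis beta_gt0 : 0 < beta.
Local Notation E := (enum (edge G)).
Local Notation V := (vertex G).
Let lam := beta^-1.
Let lam_gt0 : 0 < lam. Proof. by rewrite invr_gt0. Qed.
Implicit Types (k : {ffun edge G -> int}) (theta : V -> R).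

Let alpha := gauss_int (lam / 2).

Variable c : R.
Hypothesis c_gt0 : 0 < c.
Hypothesis fourier : forall t, \sum_(i <- symrange N) alpha i * cos (i%:~R * t) @[N --> \oo]
  --> villain_edge beta t / c.

Let bx N := box E (symrange N) ([ffun=> 0] : {ffun edge G -> int}).

Let phase k theta := \sum_(a <- E) (k a)%:~R * (theta (src a) - theta (dst a)).

Let T N theta := \sum_(k <- bx N) current_weight lam k * cos (phase k theta).

Let cE := c ^+ #|edge G|.
Let cE_gt0 : 0 < cE. Proof. exact: exprn_gt0. Qed.

Let T_cvg theta : T N theta @[N --> \oo] --> villain_weight beta theta / cE.
Proof.
have -> : villain_weight beta theta / cE =
    \prod_(a <- E) (villain_edge beta (theta (src a) - theta (dst a)) / c).
  rewrite big_enum /= big_split /= /villain_weight; congr (_ * _).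
  by rewrite prodr_const /cE -exprVn; congr (_ ^+ _); apply: eq_card.
have TE N : T N theta = \prod_(a <- E) \sum_(i <- symrange N)
    alpha i * cos (i%:~R * (theta (src a) - theta (dst a))).
  have := box_prod_cos (gauss_int_even (lam / 2)) (fun a => theta (src a) - theta (dst a))
    N [ffun=> 0] 0 (enum_uniq (edge G)).
  rewrite cos0 mulr1 => <-; apply: eq_bigr => k _.
  by rewrite add0r.
under eq_fun do rewrite TE.
apply: cvg_prod_seq => a; exact: fourier.
Qed.

Let S N := \sum_(k <- bx N) current_weight lam k.
Let Soo := villain_weight beta (fun _ : V => 0) / cE.

Let S_cvg : S N @[N --> \oo] --> Soo.
Proof.
suff -> : S = fun N => T N (fun=> 0) by exact: T_cvg.
apply/funext => N; apply: eq_bigr => k _.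
by rewrite /phase big1 ?cos0 ?mulr1 // => a _; rewrite subrr mulr0.
Qed.

Let bx_sub N M : (N <= M)%N -> {subset bx N <= bx M}.
Proof.
move=> NM k; rewrite !mem_box => /forallP kN; apply/forallP => a.
have := kN a; case: ifP => // _; rewrite !mem_symrange => /leq_trans; exact.
Qed.

Let bx_uniq N : uniq (bx N).
Proof. by rewrite uniq_box ?enum_uniq ?uniq_symrange. Qed.

(** All cosines are bounded by their value 1 at zero angles, so the tail there dominates every other
    tail uniformly in [theta]. *)
Let T_tail N theta : `|villain_weight beta theta / cE - T N theta| <= Soo - S N.
Proof.
have H M : (N <= M)%N -> `|T M theta - T N theta| <= S M - S N.
  move=> NM; apply: ler_norm_sum_tail => //; first exact: bx_sub.
  move=> k; rewrite -ler_norml normrM ger0_norm ?current_weight_ge0 //.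
  by rewrite ler_piMr ?current_weight_ge0 // cos_max.
have c1 : `|T M theta - T N theta| @[M --> \oo] --> `|villain_weight beta theta / cE - T N theta|.
  by apply: cvg_norm; apply: cvgB; [exact: T_cvg|exact: cvg_cst].
have c2 : S M - S N @[M --> \oo] --> Soo - S N.
  by apply: cvgB; [exact: S_cvg|exact: cvg_cst].
apply: ler_cvg_to c1 c2 _; exists N => // M /= NM; exact: H.
Qed.

Let div_ffun k : {ffun V -> int} := [ffun v => divergence k v].

(** Summation by parts: the frequency of a current at a vertex is its divergence. *)
Let phaseE k theta : phase k theta = \sum_v (div_ffun k v)%:~R * theta v.
Proof.
rewrite /phase big_enum /=; under eq_bigr do rewrite mulrBr; rewrite sumrB.
under [RHS]eq_bigr do rewrite ffunE /divergence rmorphB /= mulrBl !rmorph_sum /= !mulr_suml.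
rewrite sumrB; congr (_ - _).
  rewrite (partition_big (@src G) predT) //=; apply: eq_bigr => v _.
  by apply: eq_bigr => a /eqP ->.
rewrite (partition_big (@dst G) predT) //=; apply: eq_bigr => v _.
by apply: eq_bigr => a /eqP ->.
Qed.

Let poly0 N := [seq (cE * current_weight lam k, div_ffun k) | k <- bx N].

Let eps_cvg : cE * (Soo - S N) @[N --> \oo] --> 0.
Proof.
rewrite -[X in _ --> X](mulr0 cE) -[X in cE * X](subrr Soo).
by apply: cvgM; first exact: cvg_cst; apply: cvgB; [exact: cvg_cst|exact: S_cvg].
Qed.

Let K := (2 * pi) ^+ #|V| * cE : R.
Let K_gt0 : 0 < K. Proof. by rewrite mulr_gt0 // exprn_gt0 // mulr_gt0 ?pi_gt0. Qed.

Let Z g := fine (\esum_(n in @dirichlet G) (gradient_weight lam predT g n)%:E)%E.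

Lemma angle_integral_weight : angle_integral (villain_weight (G := G) beta) = K * Z (fun=> 0).
Proof.
have c1 : K * \sum_(k <- bx N) current_weight lam k *
    [forall v, divergence k v == - divergence (fun=> 0) v]%:R @[N --> \oo] -->
    K * Z (fun=> 0).
  exact: (cvgM (cvg_cst K) (current_sum_cvg lam_gt0 (fun=> 0)).2).
apply: (cvg_unique _ _ c1); first exact: norm_hausdorff.
have := @angle_integral_lim R G (villain_weight beta) poly0 (fun N => cE * (Soo - S N)) _ eps_cvg.
have div0 (v : V) : divergence (fun _ : edge G => 0 : int) v = 0.
  by rewrite /divergence !big1 ?subrr.
rewrite (_ : (fun N => _) = (fun N => K * \sum_(k <- bx N) current_weight lam k *
    [forall v, divergence k v == - divergence (fun=> 0) v]%:R)).
  apply=> N theta; rewrite /trigpoly big_map /=.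
  under eq_bigr do rewrite -phaseE -mulrA.
  rewrite -mulr_sumr -/(T N theta).
  rewrite -[villain_weight beta theta](divfK (lt0r_neq0 cE_gt0)) [_ * cE]mulrC -mulrBr.
  by rewrite normrM gtr0_norm // ler_pM2l.
apply/funext => N; rewrite big_map /K -mulrA; congr (_ * _).
rewrite mulr_sumr; apply: eq_bigr => k _ /=; rewrite -mulrA; congr (_ * (_ * _%:R)).
congr (nat_of_bool _); apply/eqP/forallP => [/ffunP D v|D].
  by have := D v; rewrite !ffunE div0 oppr0 => ->.
by apply/ffunP => v; rewrite !ffunE; have := D v; rewrite div0 oppr0 => /eqP.
Qed.

Variables (x y : V) (gamma : seq (dart G)).
Hypothesis gamma_walk : is_walk y x gamma.

Let gflow a := flow gamma (a, true).
Let dxy : {ffun V -> int} := [ffun v => (x == v)%:Z - (y == v)%:Z].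

(** Product-to-sum splits [cos (theta x - theta y) * cos (phase k theta)] into two halves with
    frequencies moved by [dxy] and by [- dxy]. *)
Let poly1 N :=
  [seq (cE * current_weight lam k / 2, [ffun v => div_ffun k v + dxy v]) | k <- bx N] ++
  [seq (cE * current_weight lam k / 2, [ffun v => div_ffun k v - dxy v]) | k <- bx N].

Let phase_dxy theta : \sum_v (dxy v)%:~R * theta v = theta x - theta y.
Proof.
have delta u : \sum_v (u == v)%:~R * theta v = theta u.
  rewrite (bigD1 u) //= eqxx mul1r big1 ?addr0 // => v /negPf uv.
  by rewrite eq_sym uv mul0r.
under eq_bigr do rewrite ffunE rmorphB mulrBl.
by rewrite sumrB !delta.
Qed.

(** The zero frequency selects currents of divergence [- dxy] or [dxy], which are gradients shifted
    by the flow of [gamma] in either direction; by reflection both halves equal half of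
    [Z gflow]. *)
Lemma angle_integral_cos_weight :
  angle_integral (fun theta => cos (theta x - theta y) * villain_weight beta theta) = K * Z gflow.
Proof.
have divg (v : V) : divergence gflow v = - dxy v.
  by rewrite (divergence_walk _ gamma_walk) ffunE opprB.
have divgN (v : V) : divergence (fun a => - gflow a) v = dxy v.
  by rewrite /divergence !sumrN -opprD -/(divergence gflow v) divg opprK.
have c1 : K * (2^-1 * (\sum_(k <- bx N) current_weight lam k *
      [forall v, divergence k v == - divergence (fun a => - gflow a) v]%:R +
    \sum_(k <- bx N) current_weight lam k *
      [forall v, divergence k v == - divergence gflow v]%:R)) @[N --> \oo] --> K * Z gflow.
  have -> : Z gflow = 2^-1 * (Z (fun a => - gflow a) + Z gflow).
    by rewrite /Z esum_gradient_weightN; field.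
  have HA := (current_sum_cvg lam_gt0 (fun a => - gflow a)).2.
  have HB := (current_sum_cvg lam_gt0 gflow).2.
  apply: cvgM; first exact: cvg_cst.
  by apply: cvgM; [exact: cvg_cst|exact: (cvgD HA HB)].
apply: (cvg_unique _ _ c1); first exact: norm_hausdorff.
have := @angle_integral_lim R G
  (fun theta => cos (theta x - theta y) * villain_weight beta theta) poly1
  (fun N => cE * (Soo - S N)) _ eps_cvg.
rewrite (_ : (fun N => _) = (fun N => K * (2^-1 * (\sum_(k <- bx N) current_weight lam k *
      [forall v, divergence k v == - divergence (fun a => - gflow a) v]%:R +
    \sum_(k <- bx N) current_weight lam k *
      [forall v, divergence k v == - divergence gflow v]%:R)))).
  apply=> N theta; rewrite /trigpoly big_cat !big_map /= -big_split /=.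
  rewrite (eq_bigr (fun k => cE * cos (theta x - theta y) *
      (current_weight lam k * cos (phase k theta)))); last first.
    move=> k _.
    have -> : \sum_v ([ffun v => div_ffun k v + dxy v] v)%:~R * theta v =
        phase k theta + (theta x - theta y).
      rewrite phaseE -phase_dxy -big_split; apply: eq_bigr => v _.
      by rewrite ffunE rmorphD mulrDl.
    have -> : \sum_v ([ffun v => div_ffun k v - dxy v] v)%:~R * theta v =
        phase k theta - (theta x - theta y).
      rewrite phaseE -phase_dxy -sumrB; apply: eq_bigr => v _.
      by rewrite ffunE rmorphB mulrBl.
    by move: (phase k theta) (theta x - theta y) => u w; rewrite cosD cosB; field.
  rewrite -mulr_sumr -/(T N theta).
  have -> : cos (theta x - theta y) * villain_weight beta theta -
      cE * cos (theta x - theta y) * T N theta =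
      cE * (cos (theta x - theta y) * (villain_weight beta theta / cE - T N theta)).
    by have := lt0r_neq0 cE_gt0; move=> ?; field.
  rewrite normrM gtr0_norm // ler_pM2l // normrM -[leRHS]mul1r.
  by rewrite ler_pM ?cos_max.
apply/funext => N; rewrite big_cat !big_map /K -!mulrA; congr (_ * _).
rewrite mulrDr mulrDr !mulr_sumr; congr (_ + _); apply: eq_bigr => k _ /=.
  have -> : ([ffun v => div_ffun k v + dxy v] == [ffun=> 0]) =
      [forall v, divergence k v == - divergence (fun a => - gflow a) v].
    apply/eqP/forallP => [/ffunP D v|D].
      by have := D v; rewrite !ffunE divgN ffunE; lia.
    by apply/ffunP => v; rewrite !ffunE; have := D v; rewrite divgN ffunE; lia.
  by ring.
have -> : ([ffun v => div_ffun k v - dxy v] == [ffun=> 0]) =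
    [forall v, divergence k v == - divergence gflow v].
  apply/eqP/forallP => [/ffunP D v|D].
    by have := D v; rewrite !ffunE divg ffunE; lia.
  by apply/ffunP => v; rewrite !ffunE; have := D v; rewrite divg ffunE; lia.
by ring.
Qed.

(** The volume of the torus and the Poisson constant, collected in [K], cancel. *)
Lemma villain_corr_dual : villain_corr beta x y = Z gflow / Z (fun=> 0).
Proof.
rewrite /villain_corr /villain_mean angle_integral_weight angle_integral_cos_weight.
by rewrite -mulf_div divff ?mul1r // gt_eqF.
Qed.

End DualRepresentation.

Theorem theorem5p2 (R : realType) (G : planeGraph) (beta : R)
    (x y : vertex G) (gamma : seq (dart G)) (e : dart G)
    (beta_gt0 : 0 < beta) (neq_xy : x <> y)
    (gamma_path : simple_path y x gamma)
    (e_from_x : origin e = x)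
    (e_leaves : target e \notin visits y gamma) :
  (forall q : rat, half_integer q ->
     ivgff_prob beta^-1 [set n : height G | A_event y gamma e q n]
       <= villain_corr beta x y)
  /\
  (forall qt : height G -> rat,
     (forall n : height G, dirichlet n -> half_integer (qt n)) ->
     (forall n n' : height G, dirichlet n -> dirichlet n' ->
        n (left_face e) = n' (left_face e) ->
        n (right_face e) = n' (right_face e) -> qt n = qt n') ->
     ivgff_prob beta^-1 [set n : height G | A_event y gamma e (qt n) n]
       <= villain_corr beta x y).
Proof.
suff main (qt : height G -> rat) :
     (forall n : height G, dirichlet n -> half_integer (qt n)) ->
     (forall n n' : height G, dirichlet n -> dirichlet n' ->
        n (left_face e) = n' (left_face e) ->
        n (right_face e) = n' (right_face e) -> qt n = qt n') ->
     ivgff_prob beta^-1 [set n : height G | A_event y gamma e (qt n) n]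
       <= villain_corr beta x y.
  by split=> [q hq|qt]; [exact: (main (fun=> q))|exact: main].
move=> qt_half qt_local.
have lam_gt0 : 0 < beta^-1 by rewrite invr_gt0.
have [c c_gt0 fourier] := villain_edge_fourier beta_gt0.
have gamma_walk : is_walk y x gamma by case/andP: gamma_path.
rewrite (villain_corr_dual beta_gt0 c_gt0 fourier gamma_walk) /ivgff_prob.
have massE (A : set (height G)) : ivgff_mass beta^-1 A =
    fine (\esum_(n in [set n | dirichlet n /\ A n])
      (gradient_weight beta^-1 predT (fun=> 0%R) n)%:E)%E.
  rewrite /ivgff_mass; congr fine; apply: eq_esum => n _; congr (expR (_ * _))%:E.
  by apply: eq_bigr => a _; rewrite subr0.
have -> : ivgff_mass beta^-1 [set: height G] = fine (\esum_(n in @dirichlet G)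
      (gradient_weight beta^-1 predT (fun=> 0%R) n)%:E)%E.
  rewrite massE; congr (fine (esum _ _)).
  by apply/seteqP; split=> n //= [].
rewrite massE /=; apply: ler_wpM2r.
  by rewrite invr_ge0 fine_ge0 // esum_ge0 // => n _; rewrite lee_fin gradient_weight_ge0.
have fin g : (\esum_(n in @dirichlet G) (gradient_weight beta^-1 predT g n)%:E)%E \is a fin_num.
  rewrite ge0_fin_numE; first exact: (current_sum_cvg lam_gt0 g).1.
  by apply: esum_ge0 => n _; rewrite lee_fin gradient_weight_ge0.
have bound := level_line_bound lam_gt0 neq_xy gamma_path qt_half qt_local.
apply: fine_le => //.
rewrite ge0_fin_numE; last by apply: esum_ge0 => n _; rewrite lee_fin gradient_weight_ge0.
by apply: le_lt_trans bound _; rewrite -ge0_fin_numE // esum_ge0 // => n _;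
  rewrite lee_fin gradient_weight_ge0.
Qed.
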